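(* Among all kernels $w$ on $[0,1]$ with $\sqrt{w}\in H^{1}_{0}(0,1)$, the Fisher information $\mathcal{I}(w)=\int_{0}^{1}\frac{(w')^{2}}{w}\,dz$ attains its minimum uniquely at $$w(z)=2\sin^{2}(\pi z),\qquad \mathcal{I}(w)=4\pi^{2}.$$ The critical points of $\mathcal{I}$ under the same constraints, understood in the amplitude parametrization $w=\phi^{2}$ with $\phi\in H^{1}_{0}(0,1)$, are exactly the harmonic kernels $w_{k}(z)=2\sin^{2}(k\pi z)$, $k=1,2,\ldots$, with critical values $\mathcal{I}(w_{k})=4k^{2}\pi^{2}$, and the Lagrange multiplier of the normalization constraint $\int_{0}^{1}w\,dz=1$ at the $k$-th critical point equals $4k^{2}\pi^{2}$.
   Context: A kernel is a probability density on $[0,1]$. In the amplitude parametrization $w=\phi^{2}$ (with $\phi\in H^1_0(0,1)$ real, possibly sign-changing), the Fisher information is $\mathcal{I}(w)=4\int_{0}^{1}(\phi')^{2}\,dz$ and the normalization constraint is $\int_{0}^{1}\phi^{2}\,dz=1$. Critical points are critical points of $4\int_{0}^{1}(\phi')^{2}$ on the $L^2$ unit sphere within $H^1_0(0,1)$, and the Lagrange multiplier is the number $\mu$ for which $\delta\big[4\int_{0}^{1}(\phi')^{2}-\mu(\int_{0}^{1}\phi^{2}-1)\big]=0$. *)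

(* Defs.v *)
(* Elements of Lebesgue and Sobolev spaces on (0,1) are
   represented by functions R -> R, whose values outside [0,1] play no role; they
   are compared up to a.e. equality on [0,1]. *)
From mathcomp Require Export all_boot all_order all_algebra.
From mathcomp Require Export all_classical all_reals all_analysis.
Export Order.TTheory GRing.Theory Num.Theory numFieldNormedType.Exports.

Set Implicit Arguments.
Unset Strict Implicit.
Unset Printing Implicit Defensive.

Local Open Scope classical_set_scope.
Local Open Scope ring_scope.

Section Defs.
Variable R : realType.
Implicit Types (u v g phi psi eta w : R -> R).

Local Notation leb := (@lebesgue_measure R).
Definition Iopen : set R := `]0, 1[%classic.
Definition I01 : set R := `[0, 1]%classic.

Definition eq_ae01 u v := {ae leb, forall x, I01 x -> u x = v x}.

Definition square_integrable u :=
  measurable_fun I01 u /\ (\int[leb]_(x in I01) (u x ^+ 2)%:E < +oo)%E.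

(* C_c^infty(0,1), extended by zero to R. *)
Definition test_function eta :=
  (forall n x, derivable (derive1n n eta) x 1) /\
  exists K : set R, [/\ compact K, K `<=` Iopen & forall x, ~ K x -> eta x = 0].

Definition is_weak_derivative u g :=
  [/\ locally_integrable Iopen u, locally_integrable Iopen g &
    forall eta, test_function eta ->
      \int[leb]_(x in I01) (u x * derive1 eta x) =
      - \int[leb]_(x in I01) (g x * eta x)].

(* A representative of the weak derivative, which is unique up to a.e. equality.
   It is the junk value 0 if u has no weak derivative, so [weak_derivative] is
   meaningful only for weakly differentiable functions. *)
Definition weak_derivative u : R -> R :=
  xget (fun=> 0) [set g | is_weak_derivative u g].

Definition H1 u := square_integrable u /\
  exists g, square_integrable g /\ is_weak_derivative u g.

(* H^1_0(0,1) is the closure of C_c^infty(0,1) in H^1(0,1). *)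
Definition H10 u := H1 u /\
  forall e : R, 0 < e -> exists eta, test_function eta /\
    (\int[leb]_(x in I01) ((u x - eta x) ^+ 2)%:E +
     \int[leb]_(x in I01) ((weak_derivative u x - derive1 eta x) ^+ 2)%:E
       < e%:E)%E.

Definition kernel_density w :=
  [/\ measurable_fun I01 w, {ae leb, forall x, I01 x -> 0 <= w x} &
      (\int[leb]_(x in I01) (w x)%:E = 1)%E].

Definition admissible_kernel w :=
  kernel_density w /\ H10 (fun x => Num.sqrt (w x)).

(* The derivative of w is its weak derivative. As a / 0 = 0, the integrand is 0
   where w vanishes; this is the usual convention (w' = 0 a.e. on {w = 0}). *)
Definition fisher w : \bar R :=
  (\int[leb]_(x in I01) (weak_derivative w x ^+ 2 / w x)%:E)%E.

Definition amplitude_fisher phi : R :=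
  4 * \int[leb]_(x in I01) (weak_derivative phi x ^+ 2).

Definition mass phi : R := \int[leb]_(x in I01) (phi x ^+ 2).

(* The first variation of F at phi in the direction psi exists and equals c. *)
Definition first_variation (F : (R -> R) -> R) phi psi (c : R) :=
  is_derive (0 : R) 1 (fun t : R => F (fun x => phi x + t * psi x)) c.

(* phi is a critical point of the restriction of [amplitude_fisher] to the L^2 unit
   sphere of H^1_0: its differential vanishes on the tangent space of the sphere at
   phi, that is, on the directions in which the variation of the mass is 0. *)
Definition critical_amplitude phi :=
  [/\ H10 phi, mass phi = 1 &
    forall psi, H10 psi -> first_variation mass phi psi 0 ->
      first_variation amplitude_fisher phi psi 0].

Definition lagrange_multiplier phi (m : R) :=
  forall psi, H10 psi ->
    first_variation (fun v => amplitude_fisher v - m * (mass v - 1)) phi psi 0.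

Definition critical_kernel w :=
  exists phi, critical_amplitude phi /\ eq_ae01 w (fun x => phi x ^+ 2).

Definition harmonic_kernel (k : nat) : R -> R :=
  fun z => 2 * sin (k%:R * pi * z) ^+ 2.

End Defs.

Arguments harmonic_kernel R k : clear implicits.

(* Main.v *)
Require Import Defs.
From mathcomp Require Import measurable_realfun ring lra.

(** Every statement about H^1_0 is first proved for test functions, where it is
    classical calculus, and then extended by continuity in L^2.  This works
    because a function u of H^1_0 together with its derivative g is exactly an
    element of the closure, in L^2 x L^2, of the pairs (eta, eta') with eta a test
    function ([H10_graph]); the fundamental lemma of the calculus of variations
    ([fundamental_lemma]) identifies such a g with the weak derivative.

    The minimum.  For a test function eta,
      int eta'^2 - pi^2 int eta^2 = int (eta' - pi cot(pi x) eta)^2 >= 0,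
    since the two integrands differ by the derivative of pi cot(pi x) eta^2, which
    has compact support.  This is the Poincaré inequality with its sharp constant
    ([poincare]).  For an admissible kernel w with amplitude u = sqrt w, the product
    rule w' = 2 u u' turns the Fisher information into 4 times the integral of u'^2
    over the set where u <> 0 ([fisher_amplitude]).  The set where u = 0 does not
    contribute: u has the primitive of u' as a representative, that representative
    is nonnegative, and at almost every zero it is differentiable with derivative u'
    and has a minimum ([H10_graph_ge0_zero]).  Hence the Fisher information is at
    least 4 pi^2.  In the equality case the quadratic form int v'^2 - pi^2 int v^2
    is nonnegative and vanishes at u, so u lies in its kernel: u is a weak
    eigenfunction for the eigenvalue pi^2 ([poincare_eq_eigen]).

    The critical points.  All functionals are quadratic, so first variations are
    read off from the coefficients, and phi is critical exactly when it has mass 1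
    and is a weak eigenfunction: int phi' v' = lam int phi v for all v in H^1_0, with
    lam = int phi'^2 ([critical_amplitudeP]); the Lagrange multiplier is 4 lam.  To
    classify the weak eigenfunctions ([weak_eigen_classification]), put s = sqrt lam.
    The two Wronskians
      s u cos(s x) - u' sin(s x)   and   - s u sin(s x) - u' cos(s x)
    have zero weak derivative, so by the du Bois-Reymond lemma they are constants
    ([wronskian_cst]).  Solving for u shows that u is a combination of cos(s x) and
    sin(s x).  The boundary condition at 0 removes the cosine, the one at 1 forces
    s = k pi, and the mass fixes the amplitude up to sign.  Conversely sin(k pi x) is
    in H^1_0 ([H10_graph_smooth]) and is a weak eigenfunction by integration by parts.
    The equality case of the minimum is the eigenvalue pi^2 of this list. *)

Set Implicit Arguments.
Unset Strict Implicit.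
Unset Printing Implicit Defensive.

Local Open Scope classical_set_scope.
Local Open Scope ring_scope.

(** * Smooth functions and bump functions *)

Section SmoothFunctions.
Variable R : realType.
Implicit Types (f g eta : R -> R).

Lemma is_derive1 f (x l : R) : is_derive x 1 f l -> derive1 f x = l.
Proof. by move=> fx; rewrite derive1E; exact: derive_val. Qed.

Lemma is_derive_mul f g (x a b : R) : is_derive x 1 f a -> is_derive x 1 g b ->
  is_derive x 1 (fun y => f y * g y) (f x * b + g x * a).
Proof. exact: is_deriveM. Qed.

Lemma is_derive_add f g (x a b : R) : is_derive x 1 f a -> is_derive x 1 g b ->
  is_derive x 1 (fun y => f y + g y) (a + b).
Proof. exact: is_deriveD. Qed.

Lemma is_derive_cmul f (c x a : R) : is_derive x 1 f a ->
  is_derive x 1 (fun y => c * f y) (c * a).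
Proof. exact: is_deriveZ. Qed.

(** Bounding the order makes induction possible: the derivative of a product of two
    functions that are differentiable n + 1 times is a sum of products of functions
    that are differentiable n times. *)
Definition Cder n f := forall m, (m < n)%N -> forall x, derivable (derive1n m f) x 1.
Definition smooth f := forall n x, derivable (derive1n n f) x 1.

Lemma derive1nSr n f : derive1n n.+1 f = derive1n n (derive1 f).
Proof. by rewrite /derive1n iterSr. Qed.

Lemma Cder0 f : Cder 0 f.
Proof. by move=> m; rewrite ltn0. Qed.

Lemma smoothP f : smooth f <-> forall n, Cder n f.
Proof. by split=> [sf n m _ x|cf n x]; [exact: sf|exact: (cf n.+1)]. Qed.

Lemma CderS n f : Cder n.+1 f <-> (forall x, derivable f x 1) /\ Cder n (derive1 f).
Proof.
split=> [cf|[df cf] [_|m mn] x].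
- split=> [x|m mn x]; first exact: (cf 0%N).
  by rewrite -derive1nSr; apply: cf.
- exact: df.
- by rewrite derive1nSr; apply: cf.
Qed.

Lemma Cder_primitive n f g : (forall x : R, is_derive x 1 f (g x)) -> Cder n g ->
  Cder n.+1 f.
Proof.
move=> dfg cg; apply/CderS; split=> [x|]; first by have [] := dfg x.
by have -> : (derive1 f) = g by apply/funext => x; exact: is_derive1.
Qed.

Lemma Cder_lt n f : Cder n.+1 f -> Cder n f.
Proof. by move=> cf m mn; apply: cf; apply: ltnW. Qed.

Lemma Cder_is_derive n f (x : R) : Cder n.+1 f -> is_derive x 1 f (derive1 f x).
Proof. by move=> /CderS[df _]; rewrite derive1E; exact/derivableP. Qed.

Lemma smooth_is_derive f (x : R) : smooth f -> is_derive x 1 f (derive1 f x).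
Proof. by move=> sf; apply: (@Cder_is_derive 0); exact: (smoothP f).1. Qed.

Lemma smooth_derive1 f : smooth f -> smooth (derive1 f).
Proof. by move=> sf n x; rewrite -derive1nSr. Qed.

Lemma smooth_primitive f g :
  (forall x : R, is_derive x 1 f (g x)) -> smooth g -> smooth f.
Proof.
move=> dfg /smoothP cg; apply/smoothP => -[|n]; first exact: Cder0.
exact: Cder_primitive dfg (cg n).
Qed.

Lemma smooth_continuous f : smooth f -> continuous f.
Proof.
by move=> sf x; apply/differentiable_continuous/derivable1_diffP/(sf 0%N).
Qed.

Lemma Cder_add n f g : Cder n f -> Cder n g -> Cder n (fun x => f x + g x).
Proof.
elim: n f g => [|n IH] f g cf cg; first exact: Cder0.
apply: (@Cder_primitive _ _ (fun x => derive1 f x + (derive1 g) x)).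
  move=> x; have := Cder_is_derive x cf; have := Cder_is_derive x cg.
  by move=> ? ?; exact: is_deriveD.
by move: cf cg => /CderS[_ cf] /CderS[_ cg]; exact: IH.
Qed.

Lemma Cder_mul n f g : Cder n f -> Cder n g -> Cder n (fun x => f x * g x).
Proof.
elim: n f g => [|n IH] f g cf cg; first exact: Cder0.
apply: (@Cder_primitive _ _ (fun x => f x * (derive1 g) x + g x * derive1 f x)).
  move=> x; have := Cder_is_derive x cf; have := Cder_is_derive x cg.
  by move=> ? ?; exact: is_deriveM.
have [fS gS] := (Cder_lt cf, Cder_lt cg).
by move: cf cg => /CderS[_ cf] /CderS[_ cg]; apply: Cder_add; exact: IH.
Qed.

Lemma smooth_add f g : smooth f -> smooth g -> smooth (fun x => f x + g x).
Proof. by move=> /smoothP cf /smoothP cg; apply/smoothP => n; exact: Cder_add. Qed.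

Lemma smooth_mul f g : smooth f -> smooth g -> smooth (fun x => f x * g x).
Proof. by move=> /smoothP cf /smoothP cg; apply/smoothP => n; exact: Cder_mul. Qed.

Lemma smooth_cst c : smooth (fun=> c).
Proof.
apply/smoothP => n; elim: n c => [|n IH] c; first exact: Cder0.
exact: (@Cder_primitive _ _ (fun=> 0)).
Qed.

Lemma smooth_scale c f : smooth f -> smooth (fun x => c * f x).
Proof. by apply: smooth_mul; exact: smooth_cst. Qed.

Lemma is_derive_affine f (a b x l : R) : is_derive (a * x + b) 1 f l ->
  is_derive x 1 (fun x => f (a * x + b)) (a * l).
Proof.
move=> fl; have dg : is_derive x 1 (fun x : R => a * x + b) a.
  rewrite -[X in is_derive _ _ _ X]addr0; apply: is_deriveD.
  by rewrite -[X in is_derive _ _ _ X]mulr1; exact: is_deriveZ.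
by have := @is_derive1_comp _ _ _ x _ _ fl dg; rewrite mulrC.
Qed.

Lemma smooth_affine f a b : smooth f -> smooth (fun x => f (a * x + b)).
Proof.
move=> /smoothP cf; apply/smoothP => n.
have {cf} := cf n; elim: n f => [|n IH] f cf; first exact: Cder0.
apply: (@Cder_primitive _ _ (fun x => a * (derive1 f) (a * x + b))) => [x|].
  by apply: is_derive_affine; exact: Cder_is_derive cf.
apply: Cder_mul; first exact: (smoothP _).1 (@smooth_cst a) n.
by apply: IH; move: cf => /CderS[].
Qed.

Lemma smooth_sin : smooth sin.
Proof.
suff cS n : Cder n (@sin R) /\ Cder n (@cos R) by apply/smoothP => n; case: (cS n).
elim: n => [|n [cs cc]]; first by split; exact: Cder0.
split.
  exact: (@Cder_primitive _ _ cos).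
apply: (@Cder_primitive _ _ (fun x => (-1) * sin x)) => [x|].
  by rewrite mulN1r; exact: is_derive_cos.
apply: Cder_mul cs; exact: (smoothP _).1 (@smooth_cst (-1)) n.
Qed.

Lemma smooth_cos : smooth cos.
Proof.
have -> : @cos R = (derive1 sin) by apply/funext => x;
  rewrite (is_derive1 (is_derive_sin x)).
exact/smooth_derive1/smooth_sin.
Qed.

(** The usual flat function exp (-1/x) is [flat 0].  The factors x^-m are included so
    that derivatives of members of the family are combinations of members. *)
Definition flat m (x : R) := if 0 < x then x^-1 ^+ m * expR (- x^-1) else 0.

Lemma flat_le m x : 0 <= x -> flat m.+1 x <= m.+2`!%:R * x.
Proof.
rewrite /flat; case: ifPn => [x0 _|_ x0]; last by rewrite mulr_ge0.
rewrite expRN -ler_pdivrMr// mulrAC -exprSr ler_pdivrMr ?expR_gt0//.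
rewrite -ler_pdivrMl ?ltr0n ?fact_gt0// mulrC.
apply: le_trans (expR_ge1Dxn m.+1 _); last by rewrite invr_ge0 ltW.
by rewrite lerDr.
Qed.

Lemma flat_ge0 m x : 0 <= flat m x.
Proof.
rewrite /flat; case: ifPn => // x0; apply: mulr_ge0; last exact: expR_ge0.
by rewrite exprn_ge0// invr_ge0 ltW.
Qed.

(** Serves only at 0, the one point where the formula defining [flat] changes. *)
Lemma is_derive_quad (f : R -> R) (C : R) :
  f 0 = 0 -> (forall h, `|f h| <= C * h ^+ 2) -> is_derive (0 : R) 1 f 0.
Proof.
move=> f0 fC; have C0 : 0 <= C by have := fC 1; rewrite expr1n mulr1; exact: le_trans.
have cv : h^-1 *: (f (h *: 1 + 0) - f 0) @[h --> (0 : R)^'] --> (0 : R).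
  apply/cvgr0Pnorm_le => e e0.
  near=> h; rewrite f0 subr0 addr0 /GRing.scale/= mulr1 normrM normfV.
  have h0 : 0 < `|h| by rewrite normr_gt0; near: h; exact: nbhs_dnbhs_neq.
  rewrite ler_pdivrMl// (le_trans (fC h))// -real_normK ?num_real// expr2 mulrA.
  rewrite mulrC ler_pM2l//.
  have he : `|h| <= e / (C + 1).
    near: h; apply: dnbhs0_le; rewrite divr_gt0// ltr_wpDl//.
  apply: (@le_trans _ _ ((C + 1) * `|h|)).
    by rewrite ler_wpM2r// lerDl.
  by rewrite -ler_pdivlMl ?ltr_wpDl// mulrC.
by split; [apply/cvg_ex; exists 0|apply/cvg_lim].
Unshelve. all: by end_near. Qed.

Lemma flat_quad m (x : R) : `|flat m x| <= m.+2`!%:R * x ^+ 2.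
Proof.
rewrite ger0_norm ?flat_ge0//.
have [x0|x0] := ltP 0 x; last first.
  by rewrite /flat ltNge x0 mulr_ge0// sqr_ge0.
rewrite expr2 mulrA; apply: le_trans (ler_wpM2r (ltW x0) (flat_le m (ltW x0))).
rewrite /flat x0 exprS; move: (x^-1 ^+ m) (expR _) => p e.
by rewrite le_eqVlt; apply/orP; left; apply/eqP; field; rewrite gt_eqF.
Qed.

Lemma is_derive_flat m (x : R) :
  is_derive x 1 (flat m) (flat m.+2 x - m%:R * flat m.+1 x).
Proof.
have [x0|x0|->] := ltgtP x 0.
- rewrite /flat !ifF ?(lt_gtF x0)// mulr0 subr0.
  apply: (@near_eq_is_derive _ _ _ (fun=> 0)).
    near=> y; rewrite ifF//; apply/negbTE; rewrite -leNgt ltW//.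
    by near: y; exact: lt_nbhsl.
- apply: (@near_eq_is_derive R R R (fun y : R => y^-1 ^+ m * expR (- y^-1))).
    near=> y; rewrite /flat ifT//.
    by near: y; exact: lt_nbhsr.
  rewrite /flat x0.
  have xn0 : x != 0 by rewrite gt_eqF.
  have dV : is_derive x 1 (fun y : R => y^-1) (- x ^- 2).
    have := @is_deriveV _ (fun y : R => y) x 1 1 xn0 (is_derive_id _ _).
    by rewrite /GRing.scale/= mulr1.
  have dX : is_derive x 1 (fun y : R => y^-1 ^+ m)
      (m%:R * x^-1 ^+ m.-1 * - x ^- 2).
    by have := is_deriveX m dV; rewrite exprfctE.
  have dE : is_derive x 1 (fun y : R => expR (- y^-1))
      (x ^- 2 * expR (- x^-1)).
    have dN := is_deriveN dV.
    have := @is_derive1_comp _ _ _ x _ _ (is_derive_expR _) dN.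
    by rewrite opprK mulrC.
  apply: is_derive_eq (is_derive_mul dX dE) _.
  case: m {dX} => [|m].
    by rewrite !expr0 !mul0r subr0 mulr0 addr0 !mul1r -exprVn.
  by rewrite /= -!exprVn !exprS; ring.
- rewrite {2 3}/flat ltxx mulr0 subr0; apply: (@is_derive_quad _ (m.+2`!%:R)).
    by rewrite /flat ltxx.
  exact: flat_quad.
Unshelve. all: by end_near. Qed.

Lemma smooth_flat m : smooth (flat m).
Proof.
apply/smoothP => n; elim: n m => [|n IH] m; first exact: Cder0.
apply: (Cder_primitive (is_derive_flat m)).
have -> : (fun x => flat m.+2 x - m%:R * flat m.+1 x) =
  (fun x => flat m.+2 x + (- m%:R) * flat m.+1 x).
  by apply/funext => x; rewrite mulNr.
apply: Cder_add => //; apply: Cder_mul => //.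
exact: (smoothP _).1 (@smooth_cst (- m%:R)) n.
Qed.

(** The dilation c leaves the support [a, b] unchanged, but makes the function
    converge to 1 on ]a, b[ as c tends to infinity, while staying between 0 and 1. *)
Definition bump (a b c x : R) := flat 0 (c * (x - a)) * flat 0 (c * (b - x)).

Lemma smooth_bump a b c : smooth (bump a b c).
Proof.
apply: smooth_mul.
  have := @smooth_affine _ c (- (c * a)) (@smooth_flat 0).
  by congr smooth; apply/funext => x; rewrite mulrBr.
have := @smooth_affine _ (- c) (c * b) (@smooth_flat 0).
by congr smooth; apply/funext => x; rewrite mulrBr addrC mulNr.
Qed.

Lemma flat0_le1 x : flat 0 x <= 1.
Proof.
rewrite /flat; case: ifPn => // x0; rewrite expr0 mul1r -expR0 ler_expR.
by rewrite oppr_le0 invr_ge0 ltW.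
Qed.

Lemma bump_ge0 a b c x : 0 <= bump a b c x.
Proof. by rewrite mulr_ge0// flat_ge0. Qed.

Lemma bump_le1 a b c x : bump a b c x <= 1.
Proof. by rewrite mulr_ile1// ?flat_ge0// flat0_le1. Qed.

Lemma bump_out (a b c x : R) : 0 <= c -> ~~ (a < x < b) -> bump a b c x = 0.
Proof.
move=> c0; rewrite negb_and -!leNgt => /orP[xa|bx]; rewrite /bump /flat.
  by rewrite ifF ?mul0r//; apply/negbTE; rewrite -leNgt mulr_ge0_le0// subr_le0.
rewrite [X in _ * X]ifF ?mulr0//; apply/negbTE.
by rewrite -leNgt mulr_ge0_le0// subr_le0.
Qed.

Lemma test_smooth eta : test_function eta -> smooth eta.
Proof. by case. Qed.

Lemma test_smooth_mul f eta : smooth f -> test_function eta ->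
  test_function (fun x => f x * eta x).
Proof.
move=> sf [se [K [cK KI K0]]]; split; first exact: smooth_mul.
by exists K; split=> // x /K0 ->; rewrite mulr0.
Qed.

Lemma test_bump (a b c : R) : 0 < a -> b < 1 -> 0 <= c -> test_function (bump a b c).
Proof.
move=> a0 b1 c0; split; first exact: smooth_bump.
exists `[a, b]%classic; split; first exact: segment_compact.
  by move=> x; rewrite /Iopen /= !in_itv/= => /andP[ax xb]; apply/andP; split; lra.
move=> x /= /negP xab; apply: bump_out => //; apply: contra xab.
by rewrite in_itv/= => /andP[/ltW -> /ltW ->].
Qed.

Lemma near_notin_support eta (K : set R) x :
  compact K -> (forall x, ~ K x -> eta x = 0) -> ~ K x ->
  \forall y \near x, eta y = 0 :> R.
Proof.
move=> cK K0 Kx.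
have oK : open (~` K) by apply: closed_openC; apply: compact_closed cK; exact: Rhausdorff.
by have := open_nbhs_nbhs (conj oK Kx); apply: filterS => y; exact: K0.
Qed.

Lemma test_derive1_out eta (K : set R) x :
  compact K -> (forall x, ~ K x -> eta x = 0) -> ~ K x -> derive1 eta x = 0 :> R.
Proof.
move=> cK K0 Kx; apply: is_derive1.
apply: (@near_eq_is_derive _ _ _ (fun=> 0)).
by apply: filterS (near_notin_support cK K0 Kx) => y.
Qed.

Lemma test_derive1 eta : test_function eta -> test_function (derive1 eta : R -> R).
Proof.
move=> [se [K [cK KI K0]]]; split; first exact: smooth_derive1.
by exists K; split=> // x; exact: test_derive1_out.
Qed.

Lemma test_continuous eta : test_function eta -> continuous (eta : R -> R).
Proof. by move=> /test_smooth; exact: smooth_continuous. Qed.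

Lemma compact_in_Iopen (K : set R) : compact K -> K `<=` @Iopen R ->
  exists a b, [/\ 0 < a, b < 1 & K `<=` `[a, b]%classic].
Proof.
move=> cK KI; have [->|/set0P K0] := eqVneq K set0.
  by exists (1/2), (1/2); split; [lra|lra|].
have cid : {within K, continuous (fun x : R => x)}.
  by apply: continuous_subspaceT => x; exact: cvg_id.
have [a /set_mem Ka ma] := compact_EVT_min K0 cK cid.
have [b /set_mem Kb mb] := compact_EVT_max K0 cK cid.
exists a, b; have := KI _ Ka; have := KI _ Kb.
rewrite /Iopen /= !in_itv/= => /andP[_ ?] /andP[? _]; split=> // x Kx.
by rewrite /= in_itv/= ma// ?mb//; exact/mem_set.
Qed.

End SmoothFunctions.

(** * Integrals and the L^2 inner product on the unit interval *)

Section Measurability.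
Variable R : realType.
Local Notation mu := (@lebesgue_measure R).
Local Notation II := (@I01 R).

Lemma I01_measurable : measurable II.
Proof. exact: measurable_itv. Qed.

Lemma measurable_itvs (i : interval R) :
  (R.-ocitv.-measurable).-sigma.-measurable [set` i].
Proof. exact: measurable_itv. Qed.

(** The measurable structure on the domain of the Lebesgue measure is a priori not
    the one that inference finds on R; the two have the same measurable sets. *)
Lemma I01_measurable_sigma : (R.-ocitv.-measurable).-sigma.-measurable II.
Proof. exact: measurable_itvs. Qed.

Lemma ae_lebesgue_filter : Filter (almost_everywhere mu).
Proof. exact: (ae_filter_ringOfSetsType mu). Qed.

End Measurability.

#[local] Hint Resolve I01_measurable I01_measurable_sigma measurable_itvs : core.
#[local] Existing Instance ae_lebesgue_filter.

Section SquareIntegrable.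
Variable R : realType.
Implicit Types (f g u v : R -> R).
Local Notation mu := (@lebesgue_measure R).
Local Notation II := (@I01 R).
Local Notation L2 := (@square_integrable R).
Definition integrable01 f := mu.-integrable II (EFin \o f).
Local Notation Rint01 f := (Rintegral mu II f).

Lemma I01E x : II x = (0 <= x <= 1).
Proof. by rewrite /I01 /= in_itv. Qed.

Lemma IopenE x : @Iopen R x = (0 < x < 1).
Proof. by rewrite /Iopen /= in_itv. Qed.

Lemma muI01 : mu II = 1%:E.
Proof. by rewrite /I01 lebesgue_measure_itv/= lte_fin ltr01 oppr0 adde0. Qed.

Lemma measurable_continuous f : continuous f -> measurable_fun II f.
Proof. by move=> cf; apply: measurable_funTS; exact: continuous_measurable_fun. Qed.

Lemma integrable01_measurable f : integrable01 f -> measurable_fun II f.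
Proof. by move=> /measurable_int /measurable_EFinP. Qed.

Lemma integrable01_le f g : measurable_fun II f -> integrable01 g ->
  (forall x, II x -> `|f x| <= g x) -> integrable01 f.
Proof.
move=> mf ig fg; apply: le_integrable ig => //; first exact/measurable_EFinP.
by move=> x /fg /= h; rewrite lee_fin (le_trans h)// ler_norm.
Qed.

Lemma integrable01_continuous f : continuous f -> integrable01 f.
Proof.
move=> cf; apply: continuous_compact_integrable; first exact: segment_compact.
exact: continuous_subspaceT.
Qed.

Lemma integrable01_cst (c : R) : integrable01 (fun=> c).
Proof. by apply: integrable01_continuous => x; exact: cvg_cst. Qed.

Lemma integrable01_add f g : integrable01 f -> integrable01 g ->
  integrable01 (fun x => f x + g x).
Proof. by move=> i1 i2; have := integrableD (@I01_measurable_sigma R) i1 i2. Qed.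

Lemma integrable01_scale c f : integrable01 f -> integrable01 (fun x => c * f x).
Proof. by move=> i; have := integrableZl (@I01_measurable_sigma R) c i. Qed.

Lemma integrable01_mul_bounded f g (C : R) : integrable01 f -> measurable_fun II g ->
  (forall x, II x -> `|g x| <= C) -> integrable01 (fun x => f x * g x).
Proof.
move=> fi mg gC; apply: (@integrable01_le _ (fun x => C * `|f x|)).
- by apply: measurable_funM => //; exact: integrable01_measurable.
- by apply: integrable01_scale; exact: integrable_norm.
- by move=> x /gC gx; rewrite normrM mulrC ler_wpM2r.
Qed.

Lemma Rint01_add f g : integrable01 f -> integrable01 g ->
  Rint01 (fun x => f x + g x) = Rint01 f + Rint01 g.
Proof. by apply: RintegralD. Qed.

Lemma Rint01_scale c f : integrable01 f -> Rint01 (fun x => c * f x) = c * Rint01 f.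
Proof. by apply: RintegralZl. Qed.

Lemma Rint01_sub f g : integrable01 f -> integrable01 g ->
  Rint01 (fun x => f x - g x) = Rint01 f - Rint01 g.
Proof. by apply: RintegralB. Qed.

Lemma Rint01_le f g : integrable01 f -> integrable01 g -> (forall x, II x -> f x <= g x) ->
  Rint01 f <= Rint01 g.
Proof. by apply: le_Rintegral. Qed.

Lemma Rint01_ext f g : (forall x, II x -> f x = g x) -> Rint01 f = Rint01 g.
Proof. by move=> h; apply: eq_Rintegral => x /set_mem; exact: h. Qed.

Lemma Rint01_cst (c : R) : Rint01 (fun=> c) = c.
Proof.
rewrite Rintegral_cst//; transitivity (c * fine 1%:E); last by rewrite mulr1.
by congr (_ * fine _); exact: muI01.
Qed.

Lemma Rint01_ge0 f : (forall x, II x -> 0 <= f x) -> 0 <= Rint01 f.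
Proof. by move=> f0; apply: fine_ge0; apply: integral_ge0 => x Ix; rewrite lee_fin f0. Qed.

Lemma Rint01_norm_le f : integrable01 f -> `|Rint01 f| <= Rint01 (fun x => `|f x|).
Proof. by apply: le_normr_Rintegral. Qed.

Lemma Rint01_EFin f : integrable01 f -> (\int[mu]_(x in II) (f x)%:E)%E = (Rint01 f)%:E.
Proof. by move=> fi; rewrite /Rintegral fineK//; exact: integrable_fin_num. Qed.

Lemma eq_ae01_refl f : eq_ae01 f f.
Proof. exact: aeW. Qed.

Lemma eq_ae01_sym f g : eq_ae01 f g -> eq_ae01 g f.
Proof. by apply: filterS => x h /h. Qed.

Lemma eq_ae01_trans f g u : eq_ae01 f g -> eq_ae01 g u -> eq_ae01 f u.
Proof. by apply: filterS2 => x h1 h2 Ix; rewrite h1// h2. Qed.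

Lemma ae_eq_Rint01 f g : measurable_fun II f -> measurable_fun II g ->
  eq_ae01 f g -> Rint01 f = Rint01 g.
Proof.
move=> mf mg fg; congr fine; apply: ae_eq_integral => //;
  [exact/measurable_EFinP|exact/measurable_EFinP|].
by apply: filterS fg => x h /h /= ->.
Qed.

Lemma integrable01_ae f g : integrable01 f -> measurable_fun II g -> eq_ae01 f g ->
  integrable01 g.
Proof.
move=> fi mg fg; have mf := integrable01_measurable fi.
apply/integrableP; split; first exact/measurable_EFinP.
have /integrableP[_] := fi; congr (_ < _)%E; apply: ae_eq_integral => //.
- by apply/measurable_EFinP; exact: measurableT_comp.
- by apply/measurable_EFinP; exact: measurableT_comp.
by apply: filterS fg => x h /h /= ->.
Qed.

Lemma Rint01_eq0_ae f : integrable01 f -> (forall x, II x -> 0 <= f x) -> Rint01 f = 0 ->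
  eq_ae01 f (fun=> 0).
Proof.
move=> fi f0 if0.
have : (\int[mu]_(x in II) `|(EFin \o f) x| = 0)%E.
  have -> : (\int[mu]_(x in II) `|(EFin \o f) x| = \int[mu]_(x in II) (f x)%:E)%E.
    by apply: eq_integral => x /set_mem Ix /=; rewrite ger0_norm// f0.
  by rewrite Rint01_EFin// if0.
move/(ae_eq_integral_abs _ (@I01_measurable_sigma R) (measurable_int _ fi)).
by apply: filterS => x h /h /= [].
Qed.

Lemma L2P f : L2 f <-> measurable_fun II f /\ integrable01 (fun x => f x ^+ 2).
Proof.
split=> [[mf foo]|[mf fi]]; split=> //.
  apply/integrableP; split; first by apply/measurable_EFinP; exact: measurable_funX.
  move: foo; congr (_ < _)%E; apply: eq_integral => x _ /=.
  by rewrite ger0_norm// sqr_ge0.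
have /integrableP[_] := fi; congr (_ < _)%E; apply: eq_integral => x _ /=.
by rewrite ger0_norm// sqr_ge0.
Qed.

Lemma L2_mul f g : L2 f -> L2 g -> integrable01 (fun x => f x * g x).
Proof.
move=> /L2P[mf fi] /L2P[mg gi].
apply: integrable01_le (integrable01_add fi gi) _ => [|x _]; first exact: measurable_funM.
rewrite normrM -[f x ^+ 2]real_normK ?num_real// -[g x ^+ 2]real_normK ?num_real//.
have := sqr_ge0 (`|f x| - `|g x|); have := normr_ge0 (f x); have := normr_ge0 (g x).
by nra.
Qed.

Lemma continuous_cst (c : R) : continuous (fun _ : R => c).
Proof. by move=> x; exact: cvg_cst. Qed.

Lemma continuous_sqr f : continuous f -> continuous (fun x => f x ^+ 2).
Proof.
move=> cf x; have -> : (fun x => f x ^+ 2) = (fun x => f x * f x).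
  by apply/funext => y; rewrite expr2.
by apply: cvgM; exact: cf.
Qed.

Lemma L2_continuous f : continuous f -> L2 f.
Proof.
move=> cf; apply/L2P; split; first exact: measurable_continuous.
by apply: integrable01_continuous; exact: continuous_sqr.
Qed.

Lemma L2_bounded f (C : R) : measurable_fun II f -> (forall x, II x -> `|f x| <= C) ->
  L2 f.
Proof.
move=> mf fC; apply/L2P; split=> //; apply: integrable01_le (integrable01_cst (C ^+ 2)) _.
  exact: measurable_funX.
by move=> x /fC h; rewrite normrX lerXn2r// nnegrE ?(le_trans _ h).
Qed.

Lemma L2_integrable01 f : L2 f -> integrable01 f.
Proof.
move=> sf; have := L2_mul sf (@L2_continuous (fun=> 1) (@continuous_cst 1)).
by congr integrable01; apply/funext => x; rewrite mulr1.
Qed.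

Lemma L2_scale c f : L2 f -> L2 (fun x => c * f x).
Proof.
move=> /L2P[mf fi]; apply/L2P; split; first exact: measurable_funM.
have := integrable01_scale (c ^+ 2) fi; congr integrable01; apply/funext => x;
  by rewrite exprMn.
Qed.

Lemma L2_add f g : L2 f -> L2 g -> L2 (fun x => f x + g x).
Proof.
move=> sf sg; have fgi := L2_mul sf sg.
move: sf sg => /L2P[mf fi] /L2P[mg gi]; apply/L2P; split; first exact: measurable_funD.
have := integrable01_add (integrable01_add fi gi) (integrable01_scale 2 fgi);
  congr integrable01; apply/funext => x.
by rewrite sqrrD; ring.
Qed.

Lemma L2_opp f : L2 f -> L2 (fun x => - f x).
Proof. by move=> /(L2_scale (-1)); congr L2; apply/funext => x; rewrite mulN1r. Qed.

Lemma L2_sub f g : L2 f -> L2 g -> L2 (fun x => f x - g x).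
Proof. by move=> sf /L2_opp sg; exact: L2_add. Qed.

Lemma L2_mul_continuous f g : L2 f -> continuous g -> L2 (fun x => f x * g x).
Proof.
move=> /L2P[mf fi] cg; apply/L2P; split.
  by apply: measurable_funM => //; exact: measurable_continuous.
have c2 : continuous (fun x => g x ^+ 2) by exact: continuous_sqr.
have /compact_bounded[M [_ Mb]] : compact ((fun x => g x ^+ 2) @` II).
  by apply: continuous_compact; [exact: continuous_subspaceT|exact: segment_compact].
have g2M x : II x -> `|g x ^+ 2| <= M + 1.
  by move=> Ix; apply: (Mb (M + 1)); [rewrite ltrDl|exists x].
have := integrable01_mul_bounded fi (measurable_continuous c2) g2M.
by congr integrable01; apply/funext => x; rewrite exprMn.
Qed.

Definition inner f g := Rint01 (fun x => f x * g x).

Lemma innerC f g : inner f g = inner g f.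
Proof. by apply: Rint01_ext => x _; rewrite mulrC. Qed.

Lemma innerDl f g u : L2 f -> L2 g -> L2 u ->
  inner (fun x => f x + g x) u = inner f u + inner g u.
Proof.
move=> sf sg su; rewrite /inner -Rint01_add; [|exact: L2_mul|exact: L2_mul].
by apply: Rint01_ext => x _; rewrite mulrDl.
Qed.

Lemma innerZl c f u : L2 f -> L2 u -> inner (fun x => c * f x) u = c * inner f u.
Proof.
move=> sf su; rewrite /inner -Rint01_scale; last exact: L2_mul.
by apply: Rint01_ext => x _; rewrite mulrA.
Qed.

Lemma innerDr f g u : L2 f -> L2 g -> L2 u ->
  inner u (fun x => f x + g x) = inner u f + inner u g.
Proof. by move=> *; rewrite innerC innerDl// ![inner _ u]innerC. Qed.

Lemma innerZr c f u : L2 f -> L2 u -> inner u (fun x => c * f x) = c * inner u f.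
Proof. by move=> *; rewrite innerC innerZl// [inner _ u]innerC. Qed.

Lemma innerBl f g u : L2 f -> L2 g -> L2 u ->
  inner (fun x => f x - g x) u = inner f u - inner g u.
Proof.
move=> sf sg su; rewrite /inner -Rint01_sub; [|exact: L2_mul|exact: L2_mul].
by apply: Rint01_ext => x _; rewrite mulrBl.
Qed.

Lemma innerBr f g u : L2 f -> L2 g -> L2 u ->
  inner u (fun x => f x - g x) = inner u f - inner u g.
Proof. by move=> *; rewrite innerC innerBl// ![inner _ u]innerC. Qed.

Lemma inner_ge0 f : 0 <= inner f f.
Proof. by apply: Rint01_ge0 => x _; rewrite -expr2 sqr_ge0. Qed.

Lemma inner_sqr f : inner f f = Rint01 (fun x => f x ^+ 2).
Proof. by apply: Rint01_ext => x _; rewrite expr2. Qed.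

Lemma inner_quad f g (t : R) : L2 f -> L2 g ->
  inner (fun x => f x + t * g x) (fun x => f x + t * g x) =
  inner f f + 2 * t * inner f g + t ^+ 2 * inner g g.
Proof.
move=> sf sg; have sg' := L2_scale t sg.
rewrite innerDl ?innerDr ?innerZl ?innerZr//; [|exact: L2_add].
by rewrite [inner g f]innerC; ring.
Qed.

(** The quadratic polynomial t |-> |f + t g|^2 is nonnegative; it is evaluated at its
    minimum, or, if g has norm 0, at a point where the linear term would make it
    negative. *)
Lemma CauchySchwarz f g : L2 f -> L2 g -> inner f g ^+ 2 <= inner f f * inner g g.
Proof.
move=> sf sg.
have H (t : R) : 0 <= inner f f + 2 * t * inner f g + t ^+ 2 * inner g g.
  by rewrite -inner_quad// inner_ge0.
have := inner_ge0 g; rewrite le_eqVlt => /predU1P[g0|g0].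
  rewrite -g0 mulr0; have [->|fg0] := eqVneq (inner f g) 0; first by rewrite expr0n.
  (* Here the polynomial is affine, and this t is where it takes the value -1. *)
  have := H (- (inner f f + 1) / (2 * inner f g)); rewrite -g0 mulr0 addr0.
  have -> : 2 * (- (inner f f + 1) / (2 * inner f g)) * inner f g =
    - (inner f f + 1) by field.
  by rewrite opprD addrA subrr sub0r ler0N1.
have := H (- inner f g / inner g g).
have -> : inner f f + 2 * (- inner f g / inner g g) * inner f g + (- inner f g /
  inner g g) ^+ 2 * inner g g
  = (inner f f * inner g g - inner f g ^+ 2) / inner g g by field; rewrite gt_eqF.
by rewrite pmulr_lge0 ?invr_gt0// subr_ge0.
Qed.

Lemma inner_le f g : L2 f -> L2 g ->
  `|inner f g| <= Num.sqrt (inner f f) * Num.sqrt (inner g g).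
Proof.
move=> sf sg; rewrite -sqrtrM ?inner_ge0// -sqrtr_sqr ler_sqrt.
  exact: CauchySchwarz.
by rewrite mulr_ge0 ?inner_ge0.
Qed.

Lemma cvg_sqrt0 (a : nat -> R) : a @ \oo --> (0 : R) ->
  Num.sqrt (a n) @[n --> \oo] --> (0 : R).
Proof.
move=> a0; rewrite -[X in _ --> X]sqrtr0.
exact: (cvg_comp a (Num.sqrt : R -> R) a0 (@sqrt_continuous R 0)).
Qed.

Lemma squeeze0 (a b : nat -> R) : (forall n, 0 <= a n <= b n) ->
  b @ \oo --> (0 : R) -> a @ \oo --> (0 : R).
Proof.
move=> ab b0; apply: squeeze_cvgr b0; last exact: cvg_cst.
by apply: nearW => n; exact: ab.
Qed.

Definition L2cvg (f_ : nat -> R -> R) f :=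
  inner (fun x => f x - f_ n x) (fun x => f x - f_ n x) @[n --> \oo] --> (0 : R).

Lemma L2cvg_cst f : L2cvg (fun=> f) f.
Proof.
rewrite /L2cvg; apply: (@cvg_trans _ ((fun=> 0 : R) @ \oo)); last exact: cvg_cst.
rewrite (_ : (fun=> _) = fun=> 0)//; apply/funext => n.
rewrite -[RHS](Rint01_cst 0); apply: Rint01_ext => x _.
by rewrite subrr mul0r.
Qed.

Lemma cvg_inner f g (f_ g_ : nat -> R -> R) : L2 f -> L2 g ->
  (forall n, L2 (f_ n)) -> (forall n, L2 (g_ n)) ->
  L2cvg f_ f -> L2cvg g_ g -> inner (f_ n) (g_ n) @[n --> \oo] --> inner f g.
Proof.
move=> sf sg sf_ sg_ cf cg.
have sdf n : L2 (fun x => f x - f_ n x) by exact: L2_sub.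
have sdg n : L2 (fun x => g x - g_ n x) by exact: L2_sub.
have E n : inner (f_ n) (g_ n) = inner f g - inner (fun x => f x - f_ n x) g
   - inner f (fun x => g x - g_ n x)
   + inner (fun x => f x - f_ n x) (fun x => g x - g_ n x).
  rewrite !innerBl// !innerBr//; ring.
have small (a b : nat -> R -> R) : (forall n, L2 (a n)) -> (forall n, L2 (b n)) ->
    Num.sqrt (inner (a n) (a n)) * Num.sqrt (inner (b n) (b n)) @[n --> \oo] --> (0 : R) ->
    inner (a n) (b n) @[n --> \oo] --> (0 : R).
  move=> sa sb h; apply: norm_cvg0; apply: squeeze_cvgr h; last exact: cvg_cst.
  by apply: nearW => n; rewrite normr_ge0 inner_le.
rewrite (funext E).
have L : inner f g = inner f g - 0 - 0 + 0 by rewrite !subr0 addr0.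
rewrite [X in _ --> X]L.
apply: cvgD; [apply: cvgB; [apply: cvgB; [exact: cvg_cst|]|]|].
- apply: (small _ (fun=> g)) => //.
  rewrite -[X in _ --> X](mul0r (Num.sqrt (inner g g))); apply: cvgM; last exact: cvg_cst.
  exact: cvg_sqrt0.
- apply: (small (fun=> f)) => //.
  rewrite -[X in _ --> X](mulr0 (Num.sqrt (inner f f))); apply: cvgM; first exact: cvg_cst.
  exact: cvg_sqrt0.
- apply: small => //; rewrite -[X in _ --> X](mulr0 (0 : R)).
  by apply: cvgM; exact: cvg_sqrt0.
Qed.

Lemma L2cvgD f g (f_ g_ : nat -> R -> R) (c : R) : L2 f -> L2 g ->
  (forall n, L2 (f_ n)) -> (forall n, L2 (g_ n)) ->
  L2cvg f_ f -> L2cvg g_ g ->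
  L2cvg (fun n x => f_ n x + c * g_ n x) (fun x => f x + c * g x).
Proof.
move=> sf sg sf_ sg_ cf cg.
have sdf n : L2 (fun x => f x - f_ n x) by exact: L2_sub.
have sdg n : L2 (fun x => g x - g_ n x) by exact: L2_sub.
have E n : inner (fun x => f x + c * g x - (f_ n x + c * g_ n x))
              (fun x => f x + c * g x - (f_ n x + c * g_ n x)) <=
   2 * inner (fun x => f x - f_ n x) (fun x => f x - f_ n x)
   + (2 * c ^+ 2) * inner (fun x => g x - g_ n x) (fun x => g x - g_ n x).
  rewrite -!Rint01_scale; [|exact: L2_mul|exact: L2_mul].
  rewrite -Rint01_add; [|by apply: integrable01_scale;
    exact: L2_mul|by apply: integrable01_scale; exact: L2_mul].
  have sl : L2 (fun x => f x + c * g x - (f_ n x + c * g_ n x)).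
    by apply: L2_sub; apply: L2_add => //; exact: L2_scale.
  apply: Rint01_le => [||x _]; first exact: L2_mul.
    by apply: integrable01_add; apply: integrable01_scale; exact: L2_mul.
  have := sqr_ge0 (f x - f_ n x - c * (g x - g_ n x)); lra.
apply: squeeze0 (fun n => _) _; first by move=> n; apply/andP; split;
  [exact: inner_ge0|exact: E].
have L : (0 : R) = 2 * 0 + (2 * c ^+ 2) * 0 by rewrite !mulr0 addr0.
by rewrite [X in _ --> X]L; apply: cvgD; apply: cvgM => //; exact: cvg_cst.
Qed.

Lemma dom_cvg (f_ : nat -> R -> R) f g : (forall n, measurable_fun II (f_ n)) ->
  measurable_fun II f -> integrable01 g ->
  {ae mu, forall x, II x -> f_ n x @[n --> \oo] --> f x} ->
  (forall n x, II x -> `|f_ n x| <= g x) ->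
  Rint01 (f_ n) @[n --> \oo] --> Rint01 f.
Proof.
move=> mf_ mf gi ff fg.
have ff' : {ae mu, forall x, II x ->
    (EFin \o f_ n) x @[n --> \oo] --> (EFin \o f) x}.
  by apply: filterS ff => x h Ix; apply: cvg_EFin; [exact: nearW|exact: h].
have mf' n : measurable_fun II (EFin \o f_ n) by exact/measurable_EFinP.
have fg' n x : II x -> (`|(EFin \o f_ n) x| <= (EFin \o g) x)%E.
  by move=> Ix; rewrite lee_fin fg.
have mfE : measurable_fun II (EFin \o f) by exact/measurable_EFinP.
have [||fi _] := @dominated_convergence _ _ _ mu II (@I01_measurable_sigma R) _ _ _
  mf' mfE _ gi.
- exact: ff'.
- exact: (aeW mu (fun x n => fg' n x)).
by rewrite [X in _ --> X](Rint01_EFin fi) => h; exact: (fine_cvg h).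
Qed.

Lemma L2cvg_dom (f_ : nat -> R -> R) f (C : R) : L2 f -> (forall n, L2 (f_ n)) ->
  {ae mu, forall x, II x -> f_ n x @[n --> \oo] --> f x} ->
  (forall n x, II x -> `|f x - f_ n x| <= C) -> L2cvg f_ f.
Proof.
move=> sf sf_ ff fC; rewrite /L2cvg.
rewrite -[X in _ --> X](Rint01_cst 0).
apply: (@dom_cvg _ _ (fun=> C ^+ 2)).
- by move=> n; apply: integrable01_measurable; apply: L2_mul; exact: L2_sub.
- exact: measurable_cst.
- exact: integrable01_cst.
- apply: filterS ff => x ff Ix; have h : f x - f_ n x @[n --> \oo] --> (0 : R).
    by rewrite -[X in _ --> X](subrr (f x)); apply: cvgB; [exact: cvg_cst|exact: ff].
  by rewrite -[X in _ --> X](mul0r (0 : R)); exact: (cvgM h h).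
- by move=> n x Ix; rewrite -expr2 normrX lerXn2r ?nnegrE// ?fC// (le_trans _ (fC n x Ix)).
Qed.

End SquareIntegrable.

(** * The fundamental lemma of the calculus of variations *)

Section FundamentalLemma.
Variable R : realType.
Implicit Types (f g u v eta : R -> R).
Local Notation mu := (@lebesgue_measure R).
Local Notation II := (@I01 R).
Local Notation L2 := (@square_integrable R).
Local Notation Rint01 f := (Rintegral mu II f).

Lemma is_derive_continuous f g : (forall x : R, is_derive x 1 f (g x)) -> continuous f.
Proof.
move=> df x; apply/differentiable_continuous/derivable1_diffP.
by have [] := df x.
Qed.

Lemma FTC_segment f g (a b : R) : (forall x : R, is_derive x 1 f (g x)) -> continuous g ->
  a < b -> \int[mu]_(x in `[a, b]) g x = f b - f a.
Proof.
move=> df cg ab; rewrite /Rintegral (@continuous_FTC2 _ _ f)//.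
- exact: continuous_subspaceT.
- have cf := is_derive_continuous df.
  split=> [x _||]; first by have [] := df x.
  + exact/cvg_at_right_filter/cf.
  + exact/cvg_at_left_filter/cf.
- by move=> x _; exact: is_derive1.
Qed.

Lemma Rint01_derive f g : (forall x : R, is_derive x 1 f (g x)) -> continuous g ->
  Rint01 g = f 1 - f 0.
Proof. by move=> df cg; apply: FTC_segment. Qed.

Lemma test_out eta (x : R) : test_function eta -> ~ Iopen x -> eta x = 0.
Proof. by move=> [_ [K [_ KI K0]]] Ix; apply: K0 => /KI. Qed.

Lemma test0 eta : test_function eta -> eta 0 = 0.
Proof. by move/test_out; apply; rewrite IopenE ltxx. Qed.

Lemma test1 eta : test_function eta -> eta 1 = 0.
Proof. by move/test_out; apply; rewrite IopenE ltxx andbF. Qed.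

Lemma test_is_derive eta (x : R) : test_function eta -> is_derive x 1 eta (derive1 eta x).
Proof. by move=> /test_smooth; exact: smooth_is_derive. Qed.

Lemma ae_neq (c : R) : {ae mu, forall x, x != c}.
Proof.
exists [set c]; split; [exact: measurable_set1|exact: lebesgue_measure_set1|].
by move=> x /= /negP; rewrite negbK => /eqP.
Qed.

Lemma measurable_fun_I01 u : measurable_fun (@Iopen R) u -> measurable_fun II u.
Proof. by move=> mu_;
  exact/measurable_fun_itv_obnd_cbndP/measurable_fun_itv_bndo_bndcP. Qed.

(** Lebesgue differentiation, in the form used both for the fundamental lemma and for
    the continuous representative of a function of H^1_0.  The integral starts at
    -oo so that no point of A is excluded. *)
Lemma ae_derive_integral u (A : set R) :
  (R.-ocitv.-measurable).-sigma.-measurable A ->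
  mu.-integrable A (EFin \o u) ->
  {ae mu, forall x : R,
    is_derive x 1 (fun x => \int[mu]_(t in `]-oo, x]) (u \_ A) t) ((u \_ A) x)}.
Proof.
move=> mA ui; have uAi : mu.-integrable setT (EFin \o (u \_ A)).
  rewrite -restrict_EFin.
  by case: (@integrable_mkcond _ _ R mu A (EFin \o u) mA) => h _; exact: h.
have h := @FTC1Ny R (u \_ A) _ (integrable_locally_restrict mA ui).
apply: filterS (h _) => [x /= [dF <-]|y].
  by rewrite derive1E; exact/derivableP.
by apply: integrableS uAi.
Qed.

Lemma itvNy_patch u (a b x : R) : a <= x <= b ->
  \int[mu]_(t in `]-oo, x]) (u \_ `[a, b]) t = \int[mu]_(t in `[a, x]) u t.
Proof.
move=> /andP[ax xb]; rewrite -Rintegral_mkcondr; congr Rintegral.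
apply/seteqP; split=> t /=; rewrite !in_itv/=.
  by move=> [tx /andP[-> _]].
by move=> /andP[at_ tx]; rewrite at_ tx/=; split=> //; exact: le_trans xb.
Qed.

Lemma locally_integrable_segment u (a b : R) : 0 < a -> b < 1 ->
  locally_integrable (@Iopen R) u -> mu.-integrable `[a, b] (EFin \o u).
Proof.
move=> a0 b1 [mu_ _ h].
have sub : `[a, b] `<=` @Iopen R.
  by move=> x /=; rewrite IopenE in_itv/= => /andP[? ?]; apply/andP; split; lra.
apply/integrableP; split.
  by apply/measurable_EFinP; apply: measurable_funS mu_ => //; exact: measurable_itv.
exact: (h `[a, b]%classic sub (@segment_compact R a b)).
Qed.

(** The limit y of the sequence z only has to be positive: [flat 0] tends to 1 at
    infinity.  The constant sequence gives [bump_cvg]; the sequence x - 1/(n+1), the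
    convergence of the cutoffs that exhaust the unit interval. *)
Lemma flat_dilation_cvg (z : nat -> R) (y : R) : 0 < y -> z @ \oo --> y ->
  flat 0 (n.+1%:R * z n) @[n --> \oo] --> (1 : R).
Proof.
move=> y0 zy; have h : - (n.+1%:R^-1 * (z n)^-1) @[n --> \oo] --> (0 : R).
  rewrite -[X in _ --> X]oppr0 -[X in _ --> - X](mul0r y^-1).
  apply: cvgN; apply: cvgM; first exact: cvg_harmonic.
  by apply: cvgV => //; rewrite gt_eqF.
rewrite -[X in _ --> X]expR0.
apply: cvg_trans (cvg_comp _ _ h (@continuous_expR R 0)).
apply: near_eq_cvg; near=> n.
have zn : 0 < z n by near: n; exact: cvgr_gt zy _ y0.
by rewrite /flat mulr_gt0// expr0 mul1r invfM.
Unshelve. all: by end_near. Qed.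

Lemma bump_cvg (a b x : R) : a < x < b -> bump a b n.+1%:R x @[n --> \oo] --> (1 : R).
Proof.
move=> /andP[ax xb]; rewrite -[X in _ --> X](mulr1 (1 : R)).
apply: cvgM.
  by apply: (@flat_dilation_cvg (fun=> x - a) (x - a)); [rewrite subr_gt0|exact: cvg_cst].
by apply: (@flat_dilation_cvg (fun=> b - x) (b - x)); [rewrite subr_gt0|exact: cvg_cst].
Qed.

(** The bumps with support [a, b] are admissible test functions, and they converge
    boundedly to the indicator of ]a, b[. *)
Lemma integral_segment_eq0 u (a b : R) : 0 < a -> a < b -> b < 1 ->
  locally_integrable (@Iopen R) u ->
  (forall eta, test_function eta -> Rint01 (fun x => u x * eta x) = 0) ->
  \int[mu]_(x in `[a, b]) u x = 0.
Proof.
move=> a0 ab b1 lu H.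
have ui := locally_integrable_segment a0 b1 lu.
have mu_ : measurable_fun II u by case: lu => ? _ _; exact: measurable_fun_I01.
have sub : `]a, b[ `<=` II.
  by move=> x; rewrite I01E/= in_itv/= => /andP[? ?]; apply/andP; split; lra.
have ui' : mu.-integrable `]a, b[ (EFin \o u).
  by apply: integrableS ui => //; exact: subset_itv_oo_cc.
have IE : `]a, b[%classic = II `&` `]a, b[%classic by rewrite setIidr.
rewrite -(@Rintegral_itv_bndo_bndc _ (BLeft a) b); last first.
  by apply: integrableS ui => //; apply: subset_itvl; rewrite bnd_simp.
rewrite -(@Rintegral_itv_obnd_cbnd _ a (BLeft b))//.
rewrite IE Rintegral_mkcondr.
have : Rint01 (fun x => u x * bump a b n.+1%:R x) @[n --> \oo] --> Rint01 (u \_ `]a, b[).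
  apply: (@dom_cvg _ _ _ (fun x => `|(u \_ `]a, b[) x|)).
  - move=> n; apply: measurable_funM => //; apply: measurable_continuous.
    exact/smooth_continuous/smooth_bump.
  - apply/(measurable_restrict u); [exact: measurable_itv|exact: I01_measurable|].
    by apply: measurable_funS mu_; [exact: I01_measurable|move=> x []].
  - apply: integrable_norm; rewrite -restrict_EFin.
    by apply/integrable_restrict => //; rewrite -IE.
  - apply: aeW => x Ix; rewrite patchE; case: ifPn => [/set_mem /=|/negP xab].
      rewrite in_itv/= => xab; rewrite -[X in _ --> X]mulr1.
      by apply: cvgM; [exact: cvg_cst|exact: bump_cvg].
    have -> : (fun n => u x * bump a b n.+1%:R x) = (fun=> 0).
      apply/funext => n; rewrite bump_out ?mulr0//.
      by apply/negP => h; apply: xab; apply/mem_set; rewrite /= in_itv.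
    exact: cvg_cst.
  - move=> n x Ix; rewrite patchE; case: ifPn => [_|/negP xab].
      by rewrite normrM ler_piMr// ger0_norm ?bump_ge0// bump_le1.
    rewrite bump_out ?mulr0 ?normr0//.
    by apply/negP => h; apply: xab; apply/mem_set; rewrite /= in_itv.
have -> : (fun n => Rint01 (fun x => u x * bump a b n.+1%:R x)) = (fun=> 0).
  by apply/funext => n; apply: H; exact: test_bump.
by move=> h; apply/esym; apply: (cvg_unique (@Rhausdorff R) _ h); exact: cvg_cst.
Qed.

(** All integrals over segments vanish, so the primitives of u are locally constant;
    their derivative is u almost everywhere.  As u is only locally integrable, this is
    done on each segment [1/(n+3), 1 - 1/(n+3)]. *)
Lemma fundamental_lemma u : locally_integrable (@Iopen R) u ->
  (forall eta, test_function eta -> Rint01 (fun x => u x * eta x) = 0) ->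
  eq_ae01 u (fun=> 0).
Proof.
move=> lu H.
pose a n : R := n.+3%:R^-1.
have a0 n : 0 < a n by rewrite invr_gt0.
have K n : {ae mu, forall x, a n < x < 1 - a n -> u x = 0}.
  have := ae_derive_integral _ (locally_integrable_segment (a0 n) _ lu).
  move=> /(_ (1 - a n)); have an := a0 n.
  move=> /(_ _ _)-/(_ (measurable_itv _)) h.
  have {}h := h ltac:(lra).
  apply: filterS h => x dF xa.
  have := dF; rewrite patchE mem_set; last first.
    by rewrite /= in_itv/=; move: xa => /andP[/ltW -> /ltW ->].
  move=> dFu; apply: etrans (esym (is_derive1 dFu)) _; apply: is_derive1.
  apply: (@near_eq_is_derive _ _ _ (fun=> 0)).
  near=> y.
  have ya : a n < y < 1 - a n.
    near: y; apply: (@open_in_nearW _ _ `]a n, 1 - a n[%classic).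
    + exact: interval_open.
    + by move=> z; rewrite inE/= in_itv.
    + by rewrite inE/= in_itv.
  rewrite itvNy_patch; last by move: ya => /andP[/ltW -> /ltW ->].
  move: ya => /andP[ya yb]; rewrite integral_segment_eq0//; lra.
have K' : {ae mu, forall x, forall n, a n < x < 1 - a n -> u x = 0}.
  exact: ae_foralln.
apply: filterS3 K' (ae_neq 0) (ae_neq 1) => x h x0 x1.
rewrite I01E !le_eqVlt eq_sym (negbTE x0) (negbTE x1)/= => /andP[xp xq].
have [n hn] : exists n, a n < Num.min x (1 - x).
  have m0 : 0 < Num.min x (1 - x) by rewrite lt_min xp subr_gt0.
  exists (Num.truncn (Num.min x (1 - x))^-1).
  rewrite /a invf_plt ?posrE//.
  apply: lt_le_trans (truncnS_gt _) _; rewrite ler_nat.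
  exact: leq_trans (leqnSn _) (leqnSn _).
apply: (h n); move: hn; rewrite lt_min => /andP[-> h2]; lra.
Unshelve. all: by end_near. Qed.

End FundamentalLemma.

(** * Primitives of test functions and the du Bois-Reymond lemma *)

Section TestPrimitives.
Variable R : realType.
Implicit Types (f g u v eta : R -> R).
Local Notation mu := (@lebesgue_measure R).
Local Notation II := (@I01 R).
Local Notation L2 := (@square_integrable R).
Local Notation Rint01 f := (Rintegral mu II f).

Lemma integrable01_locally u : integrable01 u -> locally_integrable (@Iopen R) u.
Proof.
move=> ui; apply: open_integrable_locally; first exact: interval_open.
apply: integrableS ui => //; first exact: measurable_itvs.
exact: subset_itv_oo_cc.
Qed.

Lemma test_add eta1 eta2 : test_function eta1 -> test_function eta2 ->
  test_function (fun x => eta1 x + eta2 x).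
Proof.
move=> [s1 [K1 [c1 K1I K10]]] [s2 [K2 [c2 K2I K20]]]; split; first exact: smooth_add.
exists (K1 `|` K2); split.
- exact: compactU.
- by move=> x [/K1I|/K2I].
- by move=> x /not_orP[/K10 -> /K20 ->]; rewrite addr0.
Qed.

Lemma test_scale c eta : test_function eta -> test_function (fun x => c * eta x).
Proof. by apply: test_smooth_mul; exact: smooth_cst. Qed.

Lemma test_integrable01 eta : test_function eta -> integrable01 eta.
Proof. by move=> /test_continuous; exact: integrable01_continuous. Qed.

Lemma test_L2 eta : test_function eta -> L2 eta.
Proof. by move=> /test_continuous; exact: L2_continuous. Qed.

Lemma test_segment eta : test_function eta -> exists a b : R, [/\ 0 < a, b < 1 &
  forall x, ~~ (a <= x <= b) -> eta x = 0].
Proof.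
move=> [_ [K [cK KI K0]]]; have [a [b [a0 b1 Kab]]] := compact_in_Iopen cK KI.
exists a, b; split=> // x /negP xab; apply: K0 => /Kab; rewrite /= in_itv/=.
exact: xab.
Qed.

(** The integral from 0 vanishes to the left of the support, and also to its right,
    where it has reached the total integral 0. *)
Lemma test_primitive eta : test_function eta -> Rint01 eta = 0 ->
  exists2 P : R -> R, test_function P & derive1 P = eta.
Proof.
move=> te e0; have [a [b [a0 b1 eab]]] := test_segment te.
have ce := test_continuous te.
pose P (x : R) := \int[mu]_(t in `[0, x]) eta t.
have Pa x : x < a -> P x = 0.
  move=> xa; rewrite /P (@eq_Rintegral _ _ _ mu _ (fun=> 0)).
    by rewrite /Rintegral integral0.
  move=> t /set_mem; rewrite /= in_itv/= => /andP[_ tx].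
  by apply: eab; rewrite negb_and -ltNge (le_lt_trans tx xa).
have patch x : b <= x -> eta \_ `[0, x] = eta.
  move=> bx; apply/funext => t; rewrite patchE; case: ifPn => // /negP tx.
  apply/esym/eab/negP => /andP[at_ tb]; apply: tx; apply/mem_set.
  by rewrite /= in_itv/= (le_trans tb bx) (le_trans (ltW a0) at_).
have Pb x : b <= x -> P x = 0.
  move=> bx; rewrite -[RHS]e0 /P Rintegral_mkcond patch//.
  by rewrite [in RHS]Rintegral_mkcond /I01 patch// ltW.
have dP (x : R) : is_derive x 1 P (eta x).
  have [xa|ax] := ltP x a.
    rewrite eab; last by rewrite negb_and -ltNge xa.
    apply: (@near_eq_is_derive _ _ _ (fun=> 0)).
    by near=> y; rewrite Pa//; near: y; exact: lt_nbhsl.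
  have x0 : 0 < x by exact: lt_le_trans ax.
  have ie : mu.-integrable `[0, (x + 1)] (EFin \o eta).
    apply: continuous_compact_integrable; first exact: segment_compact.
    exact: continuous_subspaceT.
  have x1 : x < x + 1 by rewrite ltrDl.
  have [dP PE] := @continuous_FTC1_closed R eta 0 x (x + 1) x1 ie x0 (ce x).
  by rewrite -PE derive1E; exact/derivableP.
exists P; last by apply/funext => x; exact: is_derive1.
split; first exact: smooth_primitive dP (test_smooth te).
exists `[a, b]%classic; split; first exact: segment_compact.
  by move=> x; rewrite IopenE /= in_itv/= => /andP[? ?]; apply/andP; split; lra.
move=> x; rewrite /= in_itv/= => /negP; rewrite negb_and -!ltNge => /orP[/Pa//|/ltW].
exact: Pb.
Unshelve. all: by end_near. Qed.

(** If all test functions had integral 0, the fundamental lemma would give 1 = 0. *)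
Lemma test_integral_neq0 : exists2 eta, test_function eta & Rint01 eta != 0.
Proof.
apply: contrapT => H.
have one : eq_ae01 (fun _ : R => 1) (fun=> 0).
  apply: fundamental_lemma.
    exact/integrable01_locally/integrable01_cst.
  move=> eta te; have [e0|e0] := eqVneq (Rint01 eta) 0; last by case: H; exists eta.
  by rewrite -[RHS]e0; apply: Rint01_ext => x _; rewrite mul1r.
have := @ae_eq_Rint01 R _ _ (@measurable_cst _ _ _ _ _ _) (@measurable_cst _ _ _ _ _ _) one.
by rewrite !Rint01_cst => /eqP; rewrite oner_eq0.
Qed.

(** Subtracting from eta the multiple of a fixed test function e0 that has the same
    integral leaves the derivative of a test function.  So eta and this multiple of e0
    have the same integral against u, which determines the constant, and the
    fundamental lemma applies to u - c. *)
Lemma duBoisReymond u : integrable01 u ->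
  (forall eta, test_function eta -> Rint01 (fun x => u x * derive1 eta x) = 0) ->
  exists c : R, eq_ae01 u (fun=> c).
Proof.
move=> ui H; have [e0 te0 m0] := test_integral_neq0.
have uM f : continuous f -> integrable01 (fun x => u x * f x).
  move=> cf; have /compact_bounded[M [_ Mb]] : compact (f @` II).
    by apply: continuous_compact; [exact: continuous_subspaceT|exact: segment_compact].
  apply: (@integrable01_mul_bounded _ _ _ (M + 1)) => //;
    first exact: measurable_continuous.
  by move=> x Ix; apply: (Mb (M + 1)); [rewrite ltrDl|exists x].
pose c := Rint01 (fun x => u x * e0 x) / Rint01 e0; exists c.
have uc : integrable01 (fun x => u x - c) by apply: integrable01_add => //;
  exact: integrable01_cst.
suff : eq_ae01 (fun x => u x - c) (fun=> 0).
  by apply: filterS => x h /h /eqP; rewrite subr_eq0 => /eqP.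
apply: fundamental_lemma; first exact: integrable01_locally.
move=> eta te; pose d := Rint01 eta / Rint01 e0.
have tk : test_function (fun x => eta x + (- d) * e0 x).
  by apply: test_add => //; exact: test_scale.
have ce := test_continuous te; have ce0 := test_continuous te0.
have ie := test_integrable01 te; have ie0 := test_integrable01 te0.
have k0 : Rint01 (fun x => eta x + (- d) * e0 x) = 0.
  rewrite Rint01_add ?Rint01_scale//; last exact: integrable01_scale.
  by rewrite /d mulNr divfK// subrr.
have [P tP PE] := test_primitive tk k0.
have := H _ tP; rewrite PE => Hk.
have : Rint01 (fun x => u x * eta x) = d * Rint01 (fun x => u x * e0 x).
  have E : Rint01 (fun x => u x * (eta x + - d * e0 x)) =
      Rint01 (fun x => u x * eta x) - d * Rint01 (fun x => u x * e0 x).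
    rewrite -Rint01_scale; last exact: uM.
    rewrite -Rint01_sub; [|exact: uM|by apply: integrable01_scale; exact: uM].
    by apply: Rint01_ext => x _; ring.
  by move: Hk; rewrite E => /eqP; rewrite subr_eq0 => /eqP.
move=> E; transitivity (Rint01 (fun x => u x * eta x) - c * Rint01 eta).
  rewrite -Rint01_scale// -Rint01_sub; [|exact: uM|exact: integrable01_scale].
  by apply: Rint01_ext => x _; rewrite mulrBl.
by rewrite E /c /d; field.
Qed.

End TestPrimitives.

(** * Functions of H^1_0 as limits of test functions *)

Section ClosedGraph.
Variable R : realType.
Implicit Types (f g u v eta : R -> R).
Local Notation mu := (@lebesgue_measure R).
Local Notation II := (@I01 R).
Local Notation L2 := (@square_integrable R).
Local Notation Rint01 f := (Rintegral mu II f).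

(** The closure in L^2 x L^2 of the graph of differentiation on test functions.
    Carrying the derivative g along avoids the choice made by [weak_derivative], which
    commutes with operations on u only up to a null set. *)
Definition H10_graph u g := [/\ L2 u, L2 g & exists eta_ : nat -> R -> R,
  [/\ forall n, test_function (eta_ n), L2cvg eta_ u &
      L2cvg (fun n => derive1 (eta_ n)) g]].

Lemma test_derive1_L2 eta : test_function eta -> L2 (derive1 eta).
Proof. by move=> /test_derive1; exact: test_L2. Qed.

Lemma H10_graph_test eta : test_function eta -> H10_graph eta (derive1 eta).
Proof.
move=> te; split; [exact: test_L2|exact: test_derive1_L2|].
by exists (fun=> eta); split=> //; exact: L2cvg_cst.
Qed.

Lemma H10_graph_add u g v h (c : R) : H10_graph u g -> H10_graph v h ->
  H10_graph (fun x => u x + c * v x) (fun x => g x + c * h x).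
Proof.
move=> [su sg [e1 [t1 c1 d1]]] [sv sh [e2 [t2 c2 d2]]].
split; [by apply: L2_add => //; exact: L2_scale|by apply: L2_add => //; exact: L2_scale|].
exists (fun n x => e1 n x + c * e2 n x); split.
- by move=> n; apply: test_add => //; exact: test_scale.
- by apply: (L2cvgD c su sv _ _ c1 c2) => n; exact: test_L2.
- have -> : (fun n => derive1 (fun x => e1 n x + c * e2 n x)) =
            (fun n x => derive1 (e1 n) x + c * derive1 (e2 n) x).
    apply/funext => n; apply/funext => x; apply: is_derive1.
    apply: is_derive_add; first exact: test_is_derive.
    by apply: is_derive_cmul; exact: test_is_derive.
  by apply: (L2cvgD c sg sh _ _ d1 d2) => n; exact: test_derive1_L2.
Qed.

Lemma cvg_eq_lim (a b : nat -> R) (l m : R) : (forall n, a n = b n) ->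
  a @ \oo --> l -> b @ \oo --> m -> l = m.
Proof.
move=> /funext -> al bm; exact: (cvg_unique (@Rhausdorff R) al bm).
Qed.

(** The function h does not have to vanish at the endpoints, because u does; this is
    what later detects the boundary values of u. *)
Lemma H10_graph_ibp u g h dh : H10_graph u g -> (forall x : R, is_derive x 1 h (dh x)) ->
  continuous dh -> inner g h + inner u dh = 0.
Proof.
move=> [su sg [e [te cu cg]]] dhh cdh; have ch := is_derive_continuous dhh.
have sh := L2_continuous ch; have sdh := L2_continuous cdh.
have E n : inner (derive1 (e n)) h + inner (e n) dh = 0.
  rewrite /inner -Rint01_add; [|apply: L2_mul => //;
    exact: test_derive1_L2|apply: L2_mul => //; exact: test_L2].
  have dd (x : R) : is_derive x 1 (fun x => e n x * h x)
      (derive1 (e n) x * h x + e n x * dh x).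
    apply: is_derive_eq (is_derive_mul (test_is_derive x (te n)) (dhh x)) _.
    by rewrite addrC mulrC.
  rewrite (Rint01_derive dd).
    by rewrite test1// test0// !mul0r subrr.
  have c1 := test_continuous (te n); have c2 := test_continuous (test_derive1 (te n)).
  by move=> x; apply: cvgD; apply: cvgM;
    [exact: c2|exact: ch|exact: c1|exact: cdh].
have l1 : inner (derive1 (e n)) h @[n --> \oo] --> inner g h.
  by apply: (@cvg_inner _ _ _ _ (fun=> h)) => // [n|];
    [exact: test_derive1_L2|exact: L2cvg_cst].
have l2 : inner (e n) dh @[n --> \oo] --> inner u dh.
  by apply: (@cvg_inner _ _ _ _ (fun=> dh)) => // [n|]; [exact: test_L2|exact: L2cvg_cst].
exact: (cvg_eq_lim E (cvgD l1 l2) (cvg_cst _)).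
Qed.

Lemma H10_graph_weak u g : H10_graph u g -> is_weak_derivative u g.
Proof.
move=> ug; have [su sg _] := ug; split.
- exact/integrable01_locally/L2_integrable01.
- exact/integrable01_locally/L2_integrable01.
- move=> eta te; apply/eqP; rewrite -addr_eq0 addrC; apply/eqP.
  apply: (H10_graph_ibp ug) => [x|]; first exact: test_is_derive.
  exact/test_continuous/test_derive1.
Qed.

Lemma locally_integrable_test u eta : locally_integrable (@Iopen R) u ->
  test_function eta ->
  integrable01 (fun x => u x * eta x).
Proof.
move=> lu te; have [a [b [a0 b1 eab]]] := test_segment te.
have ui := locally_integrable_segment a0 b1 lu.
have sub : `[a, b] `<=` II.
  by move=> x; rewrite I01E/= in_itv/= => /andP[? ?]; apply/andP; split; lra.
have IE : `[a, b]%classic = II `&` `[a, b]%classic by rewrite setIidr.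
have i1 : integrable01 (u \_ `[a, b]).
  rewrite /integrable01 -restrict_EFin; apply/integrable_restrict => //.
  by rewrite -IE.
have -> : (fun x => u x * eta x) = (fun x => (u \_ `[a, b]) x * eta x).
  apply/funext => x; rewrite patchE; case: ifPn => // /negP xab.
  rewrite eab ?mulr0//; apply/negP => h; apply: xab.
  by apply/mem_set; rewrite /= in_itv.
have ce := test_continuous te.
have /compact_bounded[M [_ Mb]] : compact (eta @` II).
  by apply: continuous_compact; [exact: continuous_subspaceT|exact: segment_compact].
apply: (@integrable01_mul_bounded _ _ _ (M + 1)) => //; first exact: measurable_continuous.
by move=> x Ix; apply: (Mb (M + 1)); [rewrite ltrDl|exists x].
Qed.

Lemma weak_unique u g h : is_weak_derivative u g -> is_weak_derivative u h ->
  eq_ae01 g h.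
Proof.
move=> [_ lg Hg] [_ lh Hh].
suff : eq_ae01 (fun x => g x - h x) (fun=> 0).
  by apply: filterS => x e /e /eqP; rewrite subr_eq0 => /eqP.
apply: fundamental_lemma; first exact: locally_integrableB.
move=> eta te; transitivity (Rint01 (fun x => g x * eta x) - Rint01 (fun x => h x * eta x)).
  rewrite -Rint01_sub; [|exact: locally_integrable_test|exact: locally_integrable_test].
  by apply: Rint01_ext => x _; rewrite mulrBl.
by apply/eqP; rewrite subr_eq0 -eqr_opp -Hg// -Hh.
Qed.

Lemma weak_derivative_spec u g : is_weak_derivative u g ->
  is_weak_derivative u (weak_derivative u).
Proof. by move=> ug;
  apply: (@xgetPex _ (fun=> 0) [set g | is_weak_derivative u g]); exists g.
Qed.

Lemma weak_derivative_ae u g : is_weak_derivative u g -> eq_ae01 (weak_derivative u) g.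
Proof. by move=> ug; apply: weak_unique (weak_derivative_spec ug) ug. Qed.

Lemma weak_derivative_measurable u g : is_weak_derivative u g ->
  measurable_fun II (weak_derivative u).
Proof. by move=> /weak_derivative_spec[_ [m _ _] _]; exact: measurable_fun_I01. Qed.

Lemma L2_ae f g : L2 f -> measurable_fun II g -> eq_ae01 f g -> L2 g.
Proof.
move=> /L2P[mf fi] mg fg; apply/L2P; split=> //.
apply: integrable01_ae fi _ _; first exact: measurable_funX.
by apply: filterS fg => x h /h ->.
Qed.

Lemma L2cvg_ae (f_ : nat -> R -> R) f g : (forall n, L2 (f_ n)) -> L2 f -> L2 g ->
  eq_ae01 f g -> L2cvg f_ f -> L2cvg f_ g.
Proof.
move=> sf_ sf sg fg.
have E n : inner (fun x => f x - f_ n x) (fun x => f x - f_ n x) =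
    inner (fun x => g x - f_ n x) (fun x => g x - f_ n x).
  have s1 := L2_sub sf (sf_ n); have s2 := L2_sub sg (sf_ n).
  apply: ae_eq_Rint01.
  - exact: integrable01_measurable (L2_mul s1 s1).
  - exact: integrable01_measurable (L2_mul s2 s2).
  - by apply: filterS fg => x h /h ->.
by rewrite /L2cvg (funext E).
Qed.

Lemma H10_graph_ae u g v h : H10_graph u g -> measurable_fun II v -> measurable_fun II h ->
  eq_ae01 u v -> eq_ae01 g h -> H10_graph v h.
Proof.
move=> [su sg [e [te cu cg]]] mv mh uv gh.
have sv := L2_ae su mv uv; have sh := L2_ae sg mh gh.
split=> //; exists e; split=> //.
  by apply: L2cvg_ae uv cu => // n; exact: test_L2.
by apply: L2cvg_ae gh cg => // n; exact: test_derive1_L2.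
Qed.

Lemma inner_EFin f : L2 f -> (\int[mu]_(x in II) (f x ^+ 2)%:E)%E = (inner f f)%:E.
Proof. by move=> sf; rewrite Rint01_EFin ?inner_sqr//; case/L2P : sf. Qed.

Lemma H10_graph_H10 u g : H10_graph u g -> H10 u.
Proof.
move=> ug; have ugw := H10_graph_weak ug.
have {ug} [su sg [e [te cu cg]]] := H10_graph_ae ug (integrable01_measurable
  (L2_integrable01 (let: And3 s _ _ := ug in s)))
  (weak_derivative_measurable ugw) (@eq_ae01_refl _ u) (eq_ae01_sym
    (weak_derivative_ae ugw)).
split.
  by split=> //; exists (weak_derivative u); split=> //; exact: weak_derivative_spec ugw.
move=> eps e0; have e20 : 0 < eps / 2 by rewrite divr_gt0.
have n1 := cvgr0_norm_lt _ cu _ e20; have n2 := cvgr0_norm_lt _ cg _ e20.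
near \oo => n; exists (e n); split=> //.
rewrite !inner_EFin;
  [|apply: L2_sub => //; exact: test_derive1_L2|apply: L2_sub => //; exact: test_L2].
rewrite -EFinD lte_fin [ltRHS]splitr; apply: ltrD; apply: le_lt_trans (ler_norm _) _.
- by near: n; exact: n1.
- by near: n; exact: n2.
Unshelve. all: by end_near. Qed.

Lemma H10_H10_graph u : H10 u -> H10_graph u (weak_derivative u).
Proof.
move=> [[su [g [sg ugw]]] H].
have sw : L2 (weak_derivative u).
  exact: L2_ae sg (weak_derivative_measurable ugw) (eq_ae01_sym (weak_derivative_ae ugw)).
split=> //.
have /choice[e He] : forall n, exists eta, test_function eta /\
    inner (fun x => u x - eta x) (fun x => u x - eta x) +
    inner (fun x => weak_derivative u x - derive1 eta x)
       (fun x => weak_derivative u x - derive1 eta x) < n.+1%:R^-1.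
  move=> n; have [|eta [te]] := H n.+1%:R^-1; first by rewrite invr_gt0.
  rewrite !inner_EFin; [|apply: L2_sub => //; exact: test_derive1_L2|apply: L2_sub
    => //; exact: test_L2].
  by rewrite -EFinD lte_fin => h; exists eta.
have c0 : n.+1%:R^-1 @[n --> \oo] --> (0 : R) by exact: cvg_harmonic.
exists e; split.
- by move=> n; case: (He n).
- apply: squeeze0 c0 => n; rewrite inner_ge0/=; case: (He n) => _ /ltW.
  by apply: le_trans; rewrite lerDl inner_ge0.
- apply: squeeze0 c0 => n; rewrite inner_ge0/=; case: (He n) => _ /ltW.
  by apply: le_trans; rewrite lerDr inner_ge0.
Qed.

Lemma amplitude_fisherE u g : H10_graph u g -> amplitude_fisher u = 4 * inner g g.
Proof.
move=> ug; have ugw := H10_graph_weak ug; have [_ sg _] := ug.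
rewrite /amplitude_fisher inner_sqr; congr (4 * _); apply: ae_eq_Rint01.
- by apply: measurable_funX; exact: weak_derivative_measurable ugw.
- by apply: integrable01_measurable; case/L2P : sg.
- by apply: filterS (weak_derivative_ae ugw) => x h /h ->.
Qed.

Lemma massE u : mass u = inner u u.
Proof. by rewrite inner_sqr. Qed.

End ClosedGraph.

(** * The Poincaré inequality *)

Section PoincareFisher.
Variable R : realType.
Implicit Types (f g u v w eta : R -> R).
Local Notation mu := (@lebesgue_measure R).
Local Notation II := (@I01 R).
Local Notation L2 := (@square_integrable R).
Local Notation Rint01 f := (Rintegral mu II f).

Lemma is_derive_cvg f (x l : R) : is_derive x 1 f l -> {for x, continuous f}.
Proof. by move=> [df _]; apply/differentiable_continuous/derivable1_diffP. Qed.

Lemma is_derive_sinM (c x : R) : is_derive x 1 (fun x => sin (c * x)) (c * cos (c * x)).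
Proof.
have := @is_derive_affine R sin c 0 x _ (is_derive_sin _).
rewrite addr0; congr is_derive; apply/funext => y; by rewrite addr0.
Qed.

Lemma is_derive_cosM (c x : R) : is_derive x 1 (fun x => cos (c * x)) (- (c * sin (c * x))).
Proof.
have := @is_derive_affine R cos c 0 x _ (is_derive_cos _).
rewrite addr0 mulrN; congr is_derive; apply/funext => y; by rewrite addr0.
Qed.

Lemma sinpi_gt0 (x : R) : Iopen x -> 0 < sin (pi * x).
Proof.
rewrite IopenE => /andP[x0 x1]; apply: sin_gt0_pi; rewrite mulr_gt0 ?pi_gt0//=.
by rewrite gtr_pMr ?pi_gt0.
Qed.

(** The difference of eta'^2 - pi^2 eta^2 and (eta' - pi cot(pi x) eta)^2 is the
    derivative of pi cot(pi x) eta^2.  The cotangent is singular at 0 and 1, but eta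
    vanishes near both points, so the product is differentiable everywhere. *)
Lemma poincare_test eta : test_function eta ->
  pi ^+ 2 * inner eta eta <= inner (derive1 eta) (derive1 eta).
Proof.
move=> te; have [_ [K [cK KI K0]]] := te.
pose C (x : R) := cos (pi * x) * (sin (pi * x))^-1.
pose S (x : R) := (sin (pi * x))^-1.
(* dG is the derivative of pi * C * eta^2, where C = cot and S = 1/sin at pi * x. *)
pose dG (x : R) := pi * (2 * C x * (eta x * derive1 eta x) - pi * S x ^+ 2 * eta x ^+ 2).
have dS (x : R) : Iopen x -> is_derive x 1 S (- (pi * C x * S x)).
  move=> Ix; have s0 := sinpi_gt0 Ix.
  apply: is_derive_eq (is_deriveV (lt0r_neq0 s0) (is_derive_sinM pi x)) _.
  rewrite /GRing.scale/= /C /S; field.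
  by rewrite gt_eqF.
have dC (x : R) : Iopen x -> is_derive x 1 C (- (pi * S x ^+ 2)).
  move=> Ix; have s0 := sinpi_gt0 Ix.
  apply: is_derive_eq (is_derive_mul (is_derive_cosM pi x) (dS x Ix)) _.
  rewrite /C /S -[in RHS](mulr1 (_ ^-1 ^+ 2)) -(cos2Dsin2 (pi * x)); field.
  by rewrite gt_eqF.
have dGP (x : R) : is_derive x 1 (fun x => pi * (C x * eta x ^+ 2)) (dG x).
  have [Ix|Ix] := pselect (@Iopen R x).
    have de := test_is_derive x te.
    have de2 := is_derive_mul de de.
    apply: is_derive_eq (is_derive_cmul pi (is_derive_mul (dC x Ix) _)) _.
    by rewrite /dG; ring.
  have nx := near_notin_support cK K0 (contra_not (KI x) Ix).
  rewrite /dG (test_out te Ix) mul0r expr0n/= !mulr0 subr0 mulr0.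
  apply: (@near_eq_is_derive _ _ _ (fun=> 0)).
  by apply: filterS nx => y ->; rewrite expr0n/= !mulr0.
have cdG : continuous dG.
  move=> x; have [Ix|Ix] := pselect (@Iopen R x).
    have cS := is_derive_cvg (dS x Ix); have cC := is_derive_cvg (dC x Ix).
    have ce := @test_continuous R eta te x.
    have ce1 := @test_continuous R _ (test_derive1 te) x.
    apply: cvgM; first exact: cvg_cst.
    apply: cvgB.
      apply: cvgM; last by apply: cvgM; [exact: ce|exact: ce1].
      by apply: cvgM; [exact: cvg_cst|exact: cC].
    apply: cvgM; last first.
      by apply: (@continuous_comp _ _ _ eta (fun y => y ^+ 2)) => //; exact: exprn_continuous.
    apply: cvgM; first exact: cvg_cst.
    by apply: (@continuous_comp _ _ _ S (fun y => y ^+ 2)) => //; exact: exprn_continuous.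
  have nx := near_notin_support cK K0 (contra_not (KI x) Ix).
  rewrite /continuous_at {2}/dG (test_out te Ix) mul0r expr0n/= !mulr0 subr0 mulr0.
  apply: cvg_near_cst; apply: filterS nx => y ey.
  by rewrite /dG ey mul0r expr0n/= !mulr0 subr0 mulr0.
have G0 : Rint01 dG = 0.
  by rewrite (Rint01_derive dGP cdG) (test0 te) (test1 te) expr0n/= !mulr0 subrr.
have se := test_L2 te; have se1 := test_derive1_L2 te.
have i1 := L2_mul se1 se1; have i2 := integrable01_scale (pi ^+ 2) (L2_mul se se).
have i12 : integrable01 (fun x =>
    derive1 eta x * derive1 eta x - pi ^+ 2 * (eta x * eta x)).
  by have := integrable01_add i1 (integrable01_scale (-1) i2); congr integrable01;
    apply/funext => x; rewrite mulN1r.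
have -> : pi ^+ 2 * inner eta eta = pi ^+ 2 * inner eta eta + Rint01 dG by rewrite G0 addr0.
rewrite -subr_ge0 opprD addrA -Rint01_scale ?L2_mul// -Rint01_sub// -Rint01_sub//;
  last exact: integrable01_continuous.
apply: Rint01_ge0 => x Ix0.
have [Ix|Ix] := pselect (@Iopen R x); last first.
  rewrite (_ : _ - _ - _ = derive1 eta x ^+ 2); first exact: sqr_ge0.
  by rewrite /dG (test_out te Ix); ring.
have s0 := sinpi_gt0 Ix.
have := sqr_ge0 (derive1 eta x - pi * C x * eta x).
congr (_ <= _).
(* With 1/sin^2 = cot^2 + 1 the integrand is a perfect square. *)
have CS : S x ^+ 2 = C x ^+ 2 + 1.
  rewrite /C /S exprMn cos2sin2; field.
  by rewrite gt_eqF.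
by rewrite /dG CS; ring.
Qed.

Lemma cvg_ge0 (a : nat -> R) (l : R) : (forall n, 0 <= a n) -> a @ \oo --> l -> 0 <= l.
Proof.
move=> a0 al; rewrite -(cvg_lim (@Rhausdorff R) al); apply: limr_ge.
  exact: cvgP al.
exact: nearW.
Qed.

Lemma cvg_norm2 (e : nat -> R -> R) u : L2 u -> (forall n, L2 (e n)) -> L2cvg e u ->
  inner (e n) (e n) @[n --> \oo] --> inner u u.
Proof. by move=> su se cu; exact: cvg_inner. Qed.

Lemma poincare u g : H10_graph u g -> pi ^+ 2 * inner u u <= inner g g.
Proof.
move=> [su sg [e [te cu cg]]]; rewrite -subr_ge0.
apply: (@cvg_ge0 (fun n =>
  inner (derive1 (e n)) (derive1 (e n)) - pi ^+ 2 * inner (e n) (e n))).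
  by move=> n; rewrite subr_ge0 poincare_test.
apply: cvgB; first by apply: cvg_norm2 => // n; exact: test_derive1_L2.
by apply: cvgM; [exact: cvg_cst|apply: cvg_norm2 => // n; exact: test_L2].
Qed.

Lemma L2cvg_unique (e : nat -> R -> R) u v : L2 u -> L2 v -> (forall n, L2 (e n)) ->
  L2cvg e u -> L2cvg e v -> eq_ae01 u v.
Proof.
move=> su sv se cu cv; have sw := L2_sub su sv.
have l1 : inner (fun x => u x - v x) (e n) @[n --> \oo] --> inner (fun x => u x - v x) u.
  by apply: (@cvg_inner _ _ _ (fun=> (fun x => u x - v x))) => //; exact: L2cvg_cst.
have l2 : inner (fun x => u x - v x) (e n) @[n --> \oo] --> inner (fun x => u x - v x) v.
  by apply: (@cvg_inner _ _ _ (fun=> (fun x => u x - v x))) => //; exact: L2cvg_cst.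
have E := cvg_unique (@Rhausdorff R) l1 l2.
have : inner (fun x => u x - v x) (fun x => u x - v x) = 0.
  by rewrite (innerBr su sv sw) E subrr.
rewrite inner_sqr => h.
have : eq_ae01 (fun x => (u x - v x) ^+ 2) (fun=> 0).
  apply: Rint01_eq0_ae h => [|x _]; last exact: sqr_ge0.
  by case/L2P : sw.
by apply: filterS => x hx /hx /eqP; rewrite sqrf_eq0 subr_eq0 => /eqP.
Qed.

(** * The primitive of the derivative as a continuous representative *)

(** On the unit interval this is the integral of g from 0 to x; as a function on R
    it has the form of [ae_derive_integral]. *)
Definition primitive g (x : R) := \int[mu]_(t in `]-oo, x]) (g \_ II) t.

Lemma primitiveE g x : II x -> primitive g x = Rint01 (g \_ `[0, x]).
Proof.
move=> Ix; rewrite /primitive /I01 itvNy_patch; last by rewrite -I01E.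
rewrite -Rintegral_mkcondr setIidr//.
by apply: subset_itvl; rewrite bnd_simp; move: Ix; rewrite I01E => /andP[].
Qed.

Lemma integrable01_patch g x : integrable01 g -> integrable01 (g \_ `[0, x]).
Proof.
move=> ig; rewrite /integrable01 -restrict_EFin; apply/integrable_restrict => //.
by apply: integrableS ig => //; exact: measurableI.
Qed.

Lemma primitive_continuous g : integrable01 g -> {within II, continuous (primitive g)}.
Proof.
move=> ig; have := @parameterized_integral_continuous R 0 1 g ler01 ig.
apply: subspace_eq_continuous => x /set_mem Ix.
have {}Ix : 0 <= x <= 1 by move: Ix; rewrite /= in_itv.
exact: (esym (itvNy_patch g Ix)).
Qed.

Lemma primitive_measurable g : integrable01 g -> measurable_fun II (primitive g).
Proof.
by move=> ig; apply: subspace_continuous_measurable_fun => //; exact: primitive_continuous.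
Qed.

Lemma primitive_derive f df x : (forall x : R, is_derive x 1 f (df x)) ->
  continuous df -> II x -> primitive df x = f x - f 0.
Proof.
move=> dff cdf Ix; have := Ix; rewrite I01E => /andP[].
rewrite le_eqVlt => /predU1P[x0 _|x0 x1].
  rewrite -x0 subrr primitiveE; last by rewrite I01E lexx ler01.
  rewrite set_itv1 -[RHS](Rintegral_set1 df 0) -Rintegral_mkcondr setIidr// => y ->.
  by rewrite I01E lexx ler01.
rewrite /primitive /I01 itvNy_patch; last by rewrite (ltW x0) x1.
exact: FTC_segment.
Qed.

(** A test function is the integral of its derivative from 0, so by Cauchy-Schwarz its
    distance to [primitive g] at any point is at most the L^2 distance of the
    derivatives. *)
Lemma L2cvg_primitive (e : nat -> R -> R) g : L2 g -> (forall n, test_function (e n)) ->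
  L2cvg (fun n => derive1 (e n)) g -> L2 (primitive g) /\ L2cvg e (primitive g).
Proof.
move=> sg te cg; have ig := L2_integrable01 sg.
pose N n := inner (fun x => g x - derive1 (e n) x) (fun x => g x - derive1 (e n) x).
have sd n : L2 (fun x => g x - derive1 (e n) x).
  by apply: L2_sub => //; exact: test_derive1_L2.
have sP : L2 (primitive g).
  apply: (@L2_bounded _ _ (Rint01 (fun x => `|g x|))); first exact: primitive_measurable.
  move=> x Ix; rewrite primitiveE//; apply: le_trans.
    exact: Rint01_norm_le (integrable01_patch x ig).
  apply: Rint01_le;
    [exact: integrable_norm (integrable01_patch x ig)|exact: integrable_norm|].
  by move=> y _; rewrite patchE; case: ifPn => // _; rewrite normr0.
have se n := test_L2 (te n).
split=> //; apply: squeeze0 cg => n; rewrite inner_ge0/= -/(N n) -[leRHS]Rint01_cst.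
have sPe := L2_sub sP (se n).
apply: Rint01_le; [exact: L2_mul|exact: integrable01_cst|move=> x Ix].
pose d y := g y - derive1 (e n) y.
have id : integrable01 d := L2_integrable01 (sd n).
have -> : primitive g x - e n x = Rint01 (d \_ `[0, x]).
  have ce1 := test_continuous (test_derive1 (te n)).
  have := primitive_derive (fun x => test_is_derive x (te n)) ce1 Ix.
  rewrite (test0 (te n)) subr0 => <-; rewrite [in X in _ - X]primitiveE//.
  rewrite primitiveE// -Rint01_sub; [|exact: integrable01_patch|].
    by apply: Rint01_ext => y _; rewrite !patchE; case: ifPn => _; rewrite ?subr0.
  by apply: integrable01_patch; exact/L2_integrable01/test_derive1_L2.
have sd1 : L2 (fun y => `|d y|).
  have /L2P[md d2] := sd n; apply/L2P; split; first exact: measurableT_comp.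
  by under eq_fun do rewrite real_normK ?num_real//.
have -> : N n = inner (fun y => `|d y|) (fun y => `|d y|) * inner (fun=> 1) (fun=> 1).
  rewrite /inner mulr1 Rint01_cst mulr1; apply: Rint01_ext => y _.
  by rewrite -normrM ger0_norm// -expr2 sqr_ge0.
have s1 : L2 (fun=> 1) := L2_continuous (@continuous_cst R 1).
apply: le_trans (CauchySchwarz sd1 s1).
have ge0 : 0 <= inner (fun y => `|d y|) (fun=> 1).
  by apply: Rint01_ge0 => y _; rewrite mulr1.
rewrite -expr2 -[leLHS](real_normK (num_real _)) lerXn2r ?nnegrE//.
apply: le_trans (Rint01_norm_le (integrable01_patch x id)) _.
apply: Rint01_le => [||y _].
- exact: integrable_norm (integrable01_patch x id).
- by apply: L2_mul.
- by rewrite mulr1 patchE; case: ifPn => // _; rewrite normr0.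
Qed.

Lemma H10_graph_primitive u g : H10_graph u g -> eq_ae01 u (primitive g).
Proof.
move=> [su sg [e [te cu cg]]]; have [sP cP] := L2cvg_primitive sg te cg.
exact: (L2cvg_unique su sP (fun n => test_L2 (te n)) cu cP).
Qed.

(** * The Fisher information of a square *)

(** The product rule (u^2)' = 2 u g in weak form.  Convergence in L^2 of the
    approximating test functions e n does not give convergence in L^2 of their squares;
    so only one factor u is approximated, and [H10_graph_ibp] is applied to u and the
    smooth function e n * eta. *)
Lemma H10_graph_ibp_sqr u g eta : H10_graph u g -> test_function eta ->
  Rint01 (fun x => u x ^+ 2 * derive1 eta x) =
  - Rint01 (fun x => (2 * (u x * g x)) * eta x).
Proof.
move=> ug te; have [su sg [e [te_ cu cg]]] := ug.
have ce := test_continuous te; have ce1 := test_continuous (test_derive1 te).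
have se n := test_L2 (te_ n); have se1 n := test_derive1_L2 (te_ n).
have sge := L2_mul_continuous sg ce; have sue := L2_mul_continuous su ce.
have sue1 := L2_mul_continuous su ce1.
have E n : inner (fun x => g x * eta x) (e n) +
    (inner (fun x => u x * eta x) (derive1 (e n)) +
     inner (fun x => u x * derive1 eta x) (e n)) = 0.
  have d (x : R) := is_derive_mul (test_is_derive x (te_ n)) (test_is_derive x te).
  have cn := test_continuous (te_ n); have cn1 := test_continuous (test_derive1 (te_ n)).
  have := H10_graph_ibp ug d _ => /(_ _)<-.
    congr (_ + _); first by apply: Rint01_ext => x _; ring.
    rewrite /inner -Rint01_add; [|exact: L2_mul|exact: L2_mul].
    by apply: Rint01_ext => x _; ring.
  by move=> x; apply: cvgD; apply: cvgM; [exact: cn|exact: ce1|exact: ce|exact: cn1].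
have lim f h h_ : L2 f -> L2 h -> (forall n, L2 (h_ n)) -> L2cvg h_ h ->
    inner f (h_ n) @[n --> \oo] --> inner f h.
  by move=> sf sh sh_ ch; apply: (@cvg_inner _ _ _ (fun=> f)) => //; exact: L2cvg_cst.
have L := cvg_eq_lim E (cvgD (lim _ _ _ sge su se cu)
   (cvgD (lim _ _ _ sue sg se1 cg) (lim _ _ _ sue1 su se cu))) (cvg_cst _).
have -> : Rint01 (fun x => u x ^+ 2 * derive1 eta x) = inner (fun x => u x *
  derive1 eta x) u.
  by apply: Rint01_ext => x _; ring.
have -> : Rint01 (fun x => 2 * (u x * g x) * eta x) =
    inner (fun x => g x * eta x) u + inner (fun x => u x * eta x) g.
  by rewrite /inner -Rint01_add; [apply: Rint01_ext => x _;
    ring|exact: L2_mul|exact: L2_mul].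
by apply/eqP; rewrite -addr_eq0 addrC -addrA L.
Qed.

Lemma continuous_ae_ge0 f (y : R) : {ae mu, forall x, II x -> 0 <= f x} ->
  Iopen y -> {for y, continuous f} -> 0 <= f y.
Proof.
move=> [N [mN N0 fN]] Iy cf; rewrite leNgt; apply/negP => fy.
have near_y : \forall z \near y, Iopen z /\ f z < 0.
  apply: filterI; first by apply: open_nbhs_nbhs; split=> //; exact: interval_open.
  exact: cvgr_lt cf _ fy.
have [e /= e0 he] := near_y.
have : (mu (ball y e) <= mu N)%E.
  apply: le_measure; rewrite ?inE//; first exact: measurable_ball.
  move=> z yz; apply: fN => /= h; have [Iz fz] := he z yz.
  have := h _; rewrite leNgt fz => /(_ _)/negP; apply => //.
  exact: subset_itv_oo_cc Iz.
rewrite N0 lebesgue_measure_ball ?(ltW e0)// lee_fin leNgt.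
by rewrite mulrn_wgt0.
Qed.

Lemma derive_at_min f (x l : R) : is_derive x 1 f l -> f x = 0 ->
  (\forall y \near x, 0 <= f y) -> l = 0.
Proof.
move=> [df dE] fx [r /= r0 hr].
have q : h^-1 *: (f (h *: 1 + x) - f x) @[h --> (0 : R)^'] --> l by rewrite -dE.
have fx0 (h : R) : `|h| < r -> 0 <= f (h *: 1 + x) - f x.
  move=> h_r; rewrite fx subr0; apply: hr.
  by rewrite /= /GRing.scale/= mulr1 opprD addrCA subrr addr0 normrN.
apply/eqP; rewrite eq_le; apply/andP; split.
  apply: (cvgr_to_le (cvg_dnbhs_at_left q)); near=> h.
  rewrite /GRing.scale/= mulr_le0_ge0//.
    by rewrite invr_le0; near: h; exact: nbhs_left_le.
  apply: fx0; rewrite ltr0_norm; last by near: h; exact: nbhs_left_lt.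
  by rewrite ltrNl; near: h; apply: nbhs_left_gt; rewrite oppr_lt0.
apply: (cvgr_to_ge (cvg_dnbhs_at_right q)); near=> h.
rewrite /GRing.scale/= mulr_ge0//.
  by rewrite invr_ge0; near: h; exact: nbhs_right_ge.
apply: fx0; rewrite gtr0_norm; last by near: h; exact: nbhs_right_gt.
by near: h; exact: nbhs_right_lt.
Unshelve. all: by end_near. Qed.

(** The continuous representative is nonnegative everywhere, so it is minimal at its
    zeros, and its derivative is g almost everywhere. *)
Lemma H10_graph_ge0_zero u g : H10_graph u g -> {ae mu, forall x, II x -> 0 <= u x} ->
  {ae mu, forall x, II x -> u x = 0 -> g x = 0}.
Proof.
move=> ug u0; have [_ sg _] := ug; have ig := L2_integrable01 sg.
have up := H10_graph_primitive ug.
have P0 (y : R) : Iopen y -> 0 <= primitive g y.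
  move=> Iy; apply: continuous_ae_ge0 => //.
    by apply: filterS2 up u0 => x e h Ix; rewrite -e// h.
  have := primitive_continuous ig; rewrite /I01 => /(continuous_within_itvP _ ltr01)[+ _ _].
  by apply; move: Iy; rewrite IopenE in_itv.
have dP := @ae_derive_integral R g _ (@I01_measurable_sigma R) ig.
have h3 : {ae mu, forall x : R, x != 0 /\ x != 1}.
  by apply: filterS2 (ae_neq 0) (ae_neq 1) => x.
apply: filterS3 h3 up dP => x [x0 x1] ux dx Ix ux0.
have Iox : Iopen x.
  by move: Ix; rewrite I01E IopenE !lt_neqAle x1 eq_sym x0 => /andP[-> ->].
move: dx; rewrite patchE mem_set// => /derive_at_min; apply.
  by rewrite -[LHS]/(primitive g x) -ux.
have : \forall y \near x, Iopen y by apply: open_nbhs_nbhs; split=> //;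
  exact: interval_open.
by apply: filterS => y; exact: P0.
Qed.

Lemma measurable_inv : measurable_fun setT (fun x : R => x^-1).
Proof.
rewrite -(setUv [set (0 : R)]); apply/measurable_funU; [exact: measurable_set1|
  by apply: measurableC; exact: measurable_set1|].
split; first exact: measurable_fun_set1.
apply: open_continuous_measurable_fun.
  apply: closed_openC; exact: closed_eq.
by move=> x; rewrite inE/= => /eqP x0; exact: inv_continuous.
Qed.

(** The integrand is (2 u g)^2 / u^2, which is 4 g^2 where u <> 0.  Where u = 0 it is
    0 by the convention on division, hence the condition on g. *)
Lemma fisher_amplitude u g w : H10_graph u g -> measurable_fun II w ->
  eq_ae01 w (fun x => u x ^+ 2) ->
  {ae mu, forall x, II x -> u x = 0 -> g x = 0} ->
  fisher w = (4 * inner g g)%:E.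
Proof.
move=> ug mw wu ug0; have [su sg _] := ug.
have mu_ : measurable_fun II u by case/L2P : su.
have mg : measurable_fun II g by case/L2P : sg.
have iw : integrable01 w.
  have /L2P[_ iu] := su; exact: integrable01_ae iu mw (eq_ae01_sym wu).
have wd : is_weak_derivative w (fun x => 2 * (u x * g x)).
  split; first exact: integrable01_locally.
    by apply: integrable01_locally; apply: integrable01_scale; exact: L2_mul.
  move=> eta te; rewrite -(H10_graph_ibp_sqr ug te).
  have m1 := measurable_continuous (test_continuous (test_derive1 te)).
  apply: ae_eq_Rint01.
  - exact: measurable_funM.
  - by apply: measurable_funM => //; exact: measurable_funX.
  - by apply: filterS wu => x h /h ->.
have [_ ig2] := (L2P g).1 sg.
rewrite inner_sqr -Rint01_scale//.
rewrite -Rint01_EFin; last exact: integrable01_scale.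
apply: ae_eq_integral => //.
- apply/measurable_EFinP; apply: measurable_funM.
    by apply: measurable_funX; exact: weak_derivative_measurable wd.
  exact: measurableT_comp measurable_inv mw.
- by apply/measurable_EFinP; apply: measurable_funM => //; exact: measurable_funX.
apply: filterS3 (weak_derivative_ae wd) wu ug0 => x hd hw h0 Ix.
rewrite hd// hw//; congr (_%:E).
have [u0|u0] := eqVneq (u x) 0; last by field.
by rewrite h0// u0 !mulr0 expr0n/= mul0r mulr0.
Qed.

End PoincareFisher.

(** * Smooth functions that vanish at the endpoints *)

Section Wronskian.
Variable R : realType.
Implicit Types (f g u v h w p q psi eta : R -> R).
Local Notation mu := (@lebesgue_measure R).
Local Notation II := (@I01 R).
Local Notation L2 := (@square_integrable R).
Local Notation Rint01 f := (Rintegral mu II f).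

(** The support [1/(n+1), 1 - 1/(n+1)] increases to the open interval (it is empty
    for n = 0) and the dilation n + 1 sends the value at each point to 1. *)
Definition cutoff n : R -> R := bump n.+1%:R^-1 (1 - n.+1%:R^-1) n.+1%:R.

Lemma test_cutoff n : test_function (cutoff n).
Proof.
have n0 : 0 < n.+1%:R^-1 :> R by rewrite invr_gt0.
by apply: test_bump => //; rewrite gtrBl.
Qed.

Lemma cutoff_cvg (x : R) : Iopen x -> cutoff n x @[n --> \oo] --> (1 : R).
Proof.
rewrite IopenE => /andP[x0 x1]; rewrite -[X in _ --> X](mulr1 (1 : R)).
have N0 : n.+1%:R^-1 @[n --> \oo] --> (0 : R) by exact: cvg_harmonic.
apply: cvgM.
  apply: (@flat_dilation_cvg _ (fun n => x - n.+1%:R^-1) x) => //.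
  by rewrite -[X in _ --> X]subr0; apply: cvgB => //; exact: cvg_cst.
apply: (@flat_dilation_cvg _ (fun n => 1 - n.+1%:R^-1 - x) (1 - x)).
  by rewrite subr_gt0.
rewrite -[X in _ --> X - _]subr0; apply: cvgB; last exact: cvg_cst.
by apply: cvgB => //; exact: cvg_cst.
Qed.

Lemma ae_Iopen : {ae mu, forall x, II x -> Iopen x}.
Proof.
apply: filterS2 (ae_neq 0) (ae_neq 1) => x x0 x1.
by rewrite I01E IopenE !lt_neqAle x1 eq_sym x0 => /andP[-> ->].
Qed.

(** It is the derivative of psi that is cut off, not psi: the derivative of a cutoff
    blows up near the endpoints.  Since psi 0 = psi 1, the integral of psi' is 0, so a
    small multiple of a fixed test function corrects the integral of the truncation to
    0.  Its primitive is a test function, and converges to psi. *)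
Lemma H10_graph_smooth psi : smooth psi -> psi 0 = 0 -> psi 1 = 0 ->
  H10_graph psi (derive1 psi).
Proof.
move=> sp p0 p1; have sdp := smooth_derive1 sp.
have cdp := smooth_continuous sdp.
have sqd := L2_continuous cdp.
pose k n x := derive1 psi x * cutoff n x.
have tk n : test_function (k n) by exact: (test_smooth_mul sdp (test_cutoff n)).
have ck : L2cvg k (derive1 psi).
  have /compact_bounded[M [_ Mb]] : compact (derive1 psi @` II).
    by apply: continuous_compact; [exact: continuous_subspaceT|exact: segment_compact].
  apply: (@L2cvg_dom _ _ _ (M + 1)) => // [n||n x Ix].
  - exact: test_L2 (tk n).
  - apply: filterS ae_Iopen => x h Ix; rewrite -[X in _ --> X]mulr1.
    by apply: cvgM; [exact: cvg_cst|exact: cutoff_cvg (h Ix)].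
  - rewrite /k -[X in X - _]mulr1 -mulrBr normrM.
    apply: le_trans (Mb (M + 1) _ _ _); [|by rewrite ltrDl|by exists x].
    rewrite ler_piMr// ger0_norm ?subr_ge0 ?bump_le1//.
    by rewrite lerBlDr lerDl bump_ge0.
have [e0 te0 m0] := @test_integral_neq0 R.
(* The integral of k n is corrected to 0 by subtracting c n * e0. *)
pose c n := Rint01 (k n) / Rint01 e0.
have c0 : c n @[n --> \oo] --> (0 : R).
  rewrite -[X in _ --> X](mul0r (Rint01 e0)^-1); apply: cvgM; last exact: cvg_cst.
  have <- : inner (derive1 psi) (fun=> 1) = 0.
    transitivity (Rint01 (derive1 psi)); first by apply: Rint01_ext => x _; rewrite mulr1.
    rewrite (Rint01_derive (fun x => smooth_is_derive x sp) cdp) p0 p1.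
    by rewrite subrr.
  have -> : (fun n => Rint01 (k n)) = (fun n => inner (k n) (fun=> 1)).
    by apply/funext => n; apply: Rint01_ext => x _; rewrite mulr1.
  have s1 := L2_continuous (@continuous_cst R 1).
  apply: (@cvg_inner _ _ _ _ (fun=> (fun=> 1))) => //.
  - by move=> n; exact: test_L2 (tk n).
  - exact: L2cvg_cst.
have tz n : test_function (fun x => k n x + (- 1) * (c n * e0 x)).
  exact: (test_add (tk n) (test_scale (-1) (test_scale (c n) te0))).
have z0 n : Rint01 (fun x => k n x + (- 1) * (c n * e0 x)) = 0.
  have ie := test_integrable01 te0.
  rewrite Rint01_add ?Rint01_scale//; last first.
  - by apply: integrable01_scale; exact: integrable01_scale.
  - exact: test_integrable01 (tk n).
  - exact: integrable01_scale.
  by rewrite /c divfK// mulN1r subrr.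
have /choice[P HP] : forall n, exists P : R -> R,
    test_function P /\ derive1 P = (fun x => k n x + (- 1) * (c n * e0 x)).
  by move=> n; have [P tP PE] := test_primitive (tz n) (z0 n); exists P.
have tP n : test_function (P n) by case: (HP n).
have se0 := test_L2 te0.
have cP : L2cvg (fun n => derive1 (P n)) (derive1 psi).
  have -> : (fun n => derive1 (P n)) = (fun n x => k n x + (- 1) * (c n * e0 x)).
    by apply/funext => n; case: (HP n).
  have -> : derive1 psi = (fun x => derive1 psi x + (- 1) * 0).
    by apply/funext => x; rewrite mulr0 addr0.
  have sz : L2 (fun=> 0) := L2_continuous (@continuous_cst R 0).
  apply: (L2cvgD (-1) sqd sz _ _ ck _) => [n|n|].
  - exact: test_L2 (tk n).
  - exact: L2_scale.
  - have E n : inner (fun x => 0 - c n * e0 x) (fun x => 0 - c n * e0 x)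
        = c n * c n * inner e0 e0.
      rewrite /inner -Rint01_scale; last exact: L2_mul.
      by apply: Rint01_ext => x _; ring.
    rewrite /L2cvg (funext E) -[X in _ --> X](mul0r (inner e0 e0)).
    apply: cvgM; last exact: cvg_cst.
    by rewrite -[X in _ --> X](mul0r (0 : R)); exact: cvgM.
have [sPr cPr] := L2cvg_primitive sqd tP cP.
have : H10_graph (primitive (derive1 psi)) (derive1 psi) by split=> //; exists P.
move/H10_graph_ae; apply.
- exact: measurable_continuous (smooth_continuous sp).
- exact: measurable_continuous.
- apply: aeW => x Ix; rewrite (primitive_derive (fun x => smooth_is_derive x sp) cdp Ix).
  by rewrite p0 subr0.
- exact: eq_ae01_refl.
Qed.

(** * Weak eigenfunctions of the Dirichlet Laplacian *)

Definition weak_eigen u g (lam : R) :=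
  forall eta, test_function eta -> inner g (derive1 eta) = lam * inner u eta.

(** If p' = s q and q' = - s p, then p and q solve the same equation y'' = - s^2 y as
    u, and the derivative s (g q - s u p) - u'' p - s g q of the expression vanishes
    formally.  The weak version uses q eta in the definition of the weak derivative g
    and p eta in the eigenvalue equation. *)
Lemma wronskian_cst u g p q (s : R) : H10_graph u g -> weak_eigen u g (s ^+ 2) ->
  smooth p -> smooth q ->
  (forall x : R, is_derive x 1 p (s * q x)) ->
  (forall x : R, is_derive x 1 q (- s * p x)) ->
  exists c : R, eq_ae01 (fun x => s * (u x * q x) - g x * p x) (fun=> c).
Proof.
move=> ug ev sp sq dp dq; have [su sg _] := ug.
have cp := smooth_continuous sp; have cq := smooth_continuous sq.
have suq := L2_mul_continuous su cq; have sgp := L2_mul_continuous sg cp.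
have sW : L2 (fun x => s * (u x * q x) - g x * p x) by apply: L2_sub => //; exact: L2_scale.
apply: duBoisReymond; first exact: L2_integrable01.
move=> eta te; have st := test_smooth te; have ce := test_continuous te.
have ce1 := test_continuous (test_derive1 te).
have de x := test_is_derive x te.
have smc f1 f2 : L2 f1 -> continuous f2 -> integrable01 (fun x => f1 x * f2 x).
  by move=> sf cg; apply: L2_integrable01; exact: L2_mul_continuous.
have E1 : inner g (fun x => q x * eta x) +
          inner u (fun x => q x * derive1 eta x + eta x * (- s * p x)) = 0.
  apply: (H10_graph_ibp ug (fun x => is_derive_mul (dq x) (de x))).
  move=> x; apply: cvgD; apply: cvgM.
  - exact: cq.
  - exact: ce1.
  - exact: ce.
  - by apply: cvgM; [exact: cvg_cst|exact: cp].
have E2 : inner g (fun x => p x * derive1 eta x + eta x * (s * q x)) =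
          s ^+ 2 * inner u (fun x => p x * eta x).
  rewrite -ev; last exact: (test_smooth_mul sp te).
  congr (inner g _); apply/funext => x.
  exact: esym (is_derive1 (is_derive_mul (dp x) (de x))).
have i f1 f2 g1 : L2 f1 -> continuous f2 -> continuous g1 ->
    integrable01 (fun x => f1 x * f2 x * g1 x).
  by move=> sf cf cg; apply: smc => //; exact: L2_mul_continuous.
have i1 := i _ _ _ sg cq ce; have i2 := i _ _ _ su cq ce1; have i3 := i _ _ _ su cp ce.
have i4 := i _ _ _ sg cp ce1.
have F1 : inner u (fun x => q x * derive1 eta x + eta x * (- s * p x)) =
   Rint01 (fun x => u x * q x * derive1 eta x) - s * Rint01 (fun x => u x * p x * eta x).
  rewrite -Rint01_scale// -Rint01_sub//; last exact: integrable01_scale.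
  by apply: Rint01_ext => x _; ring.
have F2 : inner g (fun x => p x * derive1 eta x + eta x * (s * q x)) =
   Rint01 (fun x => g x * p x * derive1 eta x) + s * Rint01 (fun x => g x * q x * eta x).
  rewrite -Rint01_scale// -Rint01_add//; last exact: integrable01_scale.
  by apply: Rint01_ext => x _; ring.
have F3 : inner g (fun x => q x * eta x) = Rint01 (fun x => g x * q x * eta x).
  by apply: Rint01_ext => x _; ring.
have F4 : inner u (fun x => p x * eta x) = Rint01 (fun x => u x * p x * eta x).
  by apply: Rint01_ext => x _; ring.
have -> : Rint01 (fun x => (s * (u x * q x) - g x * p x) * derive1 eta x) =
   s * Rint01 (fun x => u x * q x * derive1 eta x)
   - Rint01 (fun x => g x * p x * derive1 eta x).
  rewrite -Rint01_scale// -Rint01_sub//; last exact: integrable01_scale.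
  by apply: Rint01_ext => x _; ring.
move: E1 E2; rewrite F1 F2 F3 F4.
set A := Rint01 _; set B := Rint01 _; set C := Rint01 _; set D := Rint01 _.
move=> E1 E2.
have -> : B = s * C - A by lra.
have -> : D = s ^+ 2 * C - s * A by lra.
ring.
Qed.

End Wronskian.

Section Eigenfunctions.
Variable R : realType.
Implicit Types (f g u v h w p q psi eta : R -> R).
Local Notation mu := (@lebesgue_measure R).
Local Notation II := (@I01 R).
Local Notation L2 := (@square_integrable R).
Local Notation Rint01 f := (Rintegral mu II f).

Lemma smooth_sinM (s : R) : smooth (fun x => sin (s * x)).
Proof.
have -> : (fun x => sin (s * x)) = (fun x => sin (s * x + 0)).
  by apply/funext => x; rewrite addr0.
exact: (smooth_affine (@smooth_sin R)).
Qed.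

Lemma smooth_cosM (s : R) : smooth (fun x => cos (s * x)).
Proof.
have -> : (fun x => cos (s * x)) = (fun x => cos (s * x + 0)).
  by apply/funext => x; rewrite addr0.
exact: (smooth_affine (@smooth_cos R)).
Qed.

(** Integration by parts for v in H^1_0 has no boundary term, so v 1 * h 1 = v 0 * h 0
    for all h; take h = 1 and h = x. *)
Lemma H10_graph_boundary v dv : H10_graph v dv -> (forall x : R, is_derive x 1 v (dv x)) ->
  continuous dv -> v 0 = 0 /\ v 1 = 0.
Proof.
move=> vdv dvv cdv; have [sv sdv _] := vdv; have cv := is_derive_continuous dvv.
have H h dh : (forall x : R, is_derive x 1 h (dh x)) -> continuous dh ->
    v 1 * h 1 = v 0 * h 0.
  move=> dhh cdh; have ch := is_derive_continuous dhh.
  have := H10_graph_ibp vdv dhh cdh.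
  rewrite /inner -Rint01_add; [|by apply: L2_mul => //; exact: L2_continuous|
    by apply: L2_mul => //; exact: L2_continuous].
  have d (x : R) : is_derive x 1 (fun x => v x * h x) (dv x * h x + v x * dh x).
    by apply: is_derive_eq (is_derive_mul (dvv x) (dhh x)) _; ring.
  rewrite (Rint01_derive d) => [/eqP|]; first by rewrite subr_eq0 => /eqP.
  by move=> x; apply: cvgD; apply: cvgM;
    [exact: cdv|exact: ch|exact: cv|exact: cdh].
have h1 := H _ _ (fun x => is_derive_cst (1 : R) x 1) (@continuous_cst R 0).
have h2 := H _ _ (fun x : R => is_derive_id x 1) (@continuous_cst R 1).
by move: h1 h2 => /=; rewrite !mulr1 mulr0 => <- ->.
Qed.

Lemma sinnpi k : sin (k%:R * pi) = 0 :> R.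
Proof.
elim: k => [|k IH]; first by rewrite mul0r sin0.
by rewrite -addn1 natrD mulrDl mul1r sinD IH sinpi mul0r mulr0 addr0.
Qed.

Lemma sin_zero (x : R) : 0 < x -> sin x = 0 -> exists2 k : nat, (0 < k)%N & x = k%:R * pi.
Proof.
move=> x0 sx; pose k := Num.truncn (x / pi).
have xp0 : 0 <= x / pi by rewrite divr_ge0 ?pi_ge0// ltW.
have /andP[k1 k2] := truncn_itv xp0.
have {}k1 : k%:R * pi <= x by rewrite -ler_pdivlMr ?pi_gt0.
have {}k2 : x < k.+1%:R * pi by rewrite -ltr_pdivrMr ?pi_gt0.
have sy : sin (x - k%:R * pi) = 0 by rewrite sinB sx sinnpi mulr0 mul0r subrr.
have [xk|xk] := eqVneq x (k%:R * pi).
  exists k => //; rewrite lt0n; apply/eqP => k0.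
  by move: x0; rewrite xk k0 mul0r ltxx.
have : 0 < sin (x - k%:R * pi).
  apply: sin_gt0_pi; rewrite subr_gt0 lt_neqAle eq_sym xk k1/=.
  by move: k2; rewrite -natr1 mulrDl mul1r ltrBlDr addrC.
by rewrite sy ltxx.
Qed.

Lemma weak_eigen_all u g lam v h : H10_graph u g -> weak_eigen u g lam -> H10_graph v h ->
  inner g h = lam * inner u v.
Proof.
move=> [su sg _] ev [sv sh [e [te cv ch]]].
have se n := test_L2 (te n); have se1 n := test_derive1_L2 (te n).
have l1 : inner g (derive1 (e n)) @[n --> \oo] --> inner g h.
  by apply: (@cvg_inner _ _ _ (fun=> g)) => //; exact: L2cvg_cst.
have l2 : lam * inner u (e n) @[n --> \oo] --> lam * inner u v.
  apply: cvgM; first exact: cvg_cst.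
  by apply: (@cvg_inner _ _ _ (fun=> u)) => //; exact: L2cvg_cst.
exact: (cvg_eq_lim (fun n => ev _ (te n)) l1 l2).
Qed.

Lemma inner_ae f f' g g' : L2 f -> L2 f' -> L2 g -> L2 g' ->
  eq_ae01 f f' -> eq_ae01 g g' -> inner f g = inner f' g'.
Proof.
move=> sf sf' sg sg' ff gg; apply: ae_eq_Rint01.
- exact: integrable01_measurable (L2_mul sf sg).
- exact: integrable01_measurable (L2_mul sf' sg').
- by apply: filterS2 ff gg => x h1 h2 Ix; rewrite h1// h2.
Qed.

Definition sine_mode k (x : R) := sin (k%:R * pi * x).
Definition dsine_mode k (x : R) := k%:R * pi * cos (k%:R * pi * x).

Lemma sine_mode_continuous k : continuous (sine_mode k).
Proof. exact: smooth_continuous (@smooth_sinM _). Qed.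

Lemma sine_mode_L2 k : L2 (sine_mode k).
Proof. exact: L2_continuous (@sine_mode_continuous k). Qed.

Lemma H10_graph_sine_mode k : H10_graph (sine_mode k) (dsine_mode k).
Proof.
have -> : dsine_mode k = derive1 (sine_mode k).
  by apply/funext => x; apply/esym/is_derive1; exact: is_derive_sinM.
apply: H10_graph_smooth; first exact: smooth_sinM.
- by rewrite /sine_mode mulr0 sin0.
- by rewrite /sine_mode mulr1 sinnpi.
Qed.

(** Here v carries the boundary condition; the sine enters only through its second
    derivative. *)
Lemma sine_mode_eigen k v h : H10_graph v h ->
  inner h (dsine_mode k) = (k%:R * pi) ^+ 2 * inner v (sine_mode k).
Proof.
move=> vh; have [sv _ _] := vh; set c := k%:R * pi.
have d (x : R) : is_derive x 1 (dsine_mode k) (- c ^+ 2 * sine_mode k x).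
  by apply: is_derive_eq (is_derive_cmul c (is_derive_cosM c x)) _;
    rewrite /sine_mode -/c; ring.
have cd : continuous (fun x => - c ^+ 2 * sine_mode k x).
  by move=> x; apply: cvgM; [exact: cvg_cst|exact: sine_mode_continuous].
have := H10_graph_ibp vh d cd; rewrite (innerZr _ (@sine_mode_L2 k) sv).
by rewrite mulNr => /eqP; rewrite subr_eq0 => /eqP.
Qed.

(** By the eigenvalue equation sine and cosine have the same norm, and the sum of their
    squares is 1. *)
Lemma inner_sine_mode k : (0 < k)%N -> inner (sine_mode k) (sine_mode k) = 2^-1.
Proof.
move=> k0; pose c : R := k%:R * pi.
have c0 : c != 0 by rewrite mulf_neq0 ?pnatr_eq0 -?lt0n ?gt_eqF ?pi_gt0.
pose C x := cos (c * x).
have cC : continuous C by exact: smooth_continuous (@smooth_cosM c).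
have sC := L2_continuous cC; have ss := sine_mode_L2 k.
have E : inner (dsine_mode k) (dsine_mode k) = c ^+ 2 * inner C C.
  have -> : dsine_mode k = (fun x => c * C x) by [].
  by rewrite innerZl ?innerZr//; [ring|exact: L2_scale].
have := sine_mode_eigen k (H10_graph_sine_mode k);
  rewrite E -/c => /(mulfI (expf_neq0 2 c0)) CS.
have : inner C C + inner (sine_mode k) (sine_mode k) = 1.
  rewrite /inner -Rint01_add; [|exact: L2_mul|exact: L2_mul].
  by rewrite -[RHS]Rint01_cst; apply: Rint01_ext => x _;
    rewrite -!expr2 /C /sine_mode -/c cos2Dsin2.
rewrite CS => h; lra.
Qed.

(** The eigenvalue is positive by the Poincaré inequality, so its square root s is a
    frequency.  The two Wronskians form a linear system for u and g with determinant
    of constant absolute value s, whose solution is v, dv in the proof. *)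
Lemma weak_eigen_classification u g lam : H10_graph u g -> inner u u = 1 ->
  weak_eigen u g lam ->
  exists (k : nat) (c : R), [/\ (0 < k)%N, lam = (k%:R * pi) ^+ 2, c ^+ 2 = 2 &
    eq_ae01 u (fun x => c * sine_mode k x)].
Proof.
move=> ug u1 ev; have [su sg _] := ug.
have lamE : inner g g = lam by rewrite (weak_eigen_all ug ev ug) u1 mulr1.
have lam0 : 0 < lam.
  by rewrite -lamE; apply: lt_le_trans (poincare ug); rewrite u1 mulr1 exprn_gt0// pi_gt0.
pose s := Num.sqrt lam; have s0 : 0 < s by rewrite sqrtr_gt0.
have s2 : s ^+ 2 = lam by rewrite sqr_sqrtr// ltW.
have {}ev : weak_eigen u g (s ^+ 2) by rewrite s2.
have ds (x : R) := is_derive_sinM s x.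
have dc (x : R) := is_derive_cosM s x.
have [c1 W1] : exists c,
    eq_ae01 (fun x => s * (u x * cos (s * x)) - g x * sin (s * x)) (fun=> c).
  apply: (wronskian_cst ug ev (@smooth_sinM s) (@smooth_cosM s)) => // x.
  by rewrite mulNr; exact: dc.
have [c2 W2] : exists c,
    eq_ae01 (fun x => s * (u x * (-1 * sin (s * x))) - g x * cos (s * x)) (fun=> c).
  have d1 (x : R) : is_derive x 1 (fun x => cos (s * x)) (s * (-1 * sin (s * x))).
    by apply: is_derive_eq (dc x) _; ring.
  have d2 (x : R) : is_derive x 1 (fun x => -1 * sin (s * x)) (- s * cos (s * x)).
    by apply: is_derive_eq (is_derive_cmul (-1) (ds x)) _; ring.
  exact: (wronskian_cst ug ev (@smooth_cosM s) (@smooth_scale _ (-1) _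
    (@smooth_sinM s)) d1 d2).
pose v (x : R) := s^-1 * c1 * cos (s * x) + - (s^-1 * c2) * sin (s * x).
pose dv (x : R) := - c1 * sin (s * x) + - c2 * cos (s * x).
have dvP (x : R) : is_derive x 1 v (dv x).
  apply: is_derive_eq (is_derive_add (is_derive_cmul _ (dc x)) (is_derive_cmul _ (ds x))) _.
  by rewrite /dv; field; rewrite gt_eqF.
have cdv : continuous dv.
  apply: smooth_continuous.
  exact: (smooth_add (@smooth_scale _ (- c1) _ (@smooth_sinM s))
    (@smooth_scale _ (- c2) _ (@smooth_cosM s))).
have cv := is_derive_continuous dvP.
have uv : eq_ae01 u v.
  apply: filterS2 W1 W2 => x h1 h2 Ix; rewrite /v -(h1 Ix) -(h2 Ix).
  have := cos2Dsin2 (s * x); set a := cos _; set b := sin _ => ab.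
  transitivity (u x * (a ^+ 2 + b ^+ 2)); first by rewrite ab mulr1.
  by field; exact: lt0r_neq0.
have gdv : eq_ae01 g dv.
  apply: filterS2 W1 W2 => x h1 h2 Ix; rewrite /dv -(h1 Ix) -(h2 Ix).
  have := cos2Dsin2 (s * x); set a := cos _; set b := sin _ => ab.
  transitivity (g x * (a ^+ 2 + b ^+ 2)); first by rewrite ab mulr1.
  ring.
have vdv := H10_graph_ae ug (measurable_continuous cv) (measurable_continuous cdv) uv gdv.
have [v0 v1] := H10_graph_boundary vdv dvP cdv.
have c10 : c1 = 0.
  move: v0; rewrite /v !mulr0 cos0 sin0 mulr0 addr0 mulr1 => /eqP.
  by rewrite mulf_eq0 invr_eq0 gt_eqF//= => /eqP.
pose c := - (s^-1 * c2).
have vE : v = (fun x => c * sin (s * x)).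
  by apply/funext => x; rewrite /v c10 mulr0 mul0r add0r.
have iv : inner v v = 1.
  by rewrite -u1; apply: inner_ae => //; [exact: L2_continuous|exact: L2_continuous|
    exact: eq_ae01_sym|exact: eq_ae01_sym].
have sS : L2 (fun x => sin (s * x)).
  exact: L2_continuous (smooth_continuous (@smooth_sinM s)).
have ivE : inner v v = c ^+ 2 * inner (fun x => sin (s * x)) (fun x => sin (s * x)).
  by rewrite vE innerZl ?innerZr//; [ring|exact: L2_scale].
have c0 : c != 0.
  by apply: contra_eq_neq iv => c0; rewrite ivE c0 expr0n/= mul0r eq_sym oner_eq0.
have /(sin_zero s0)[k k0 sk] : sin s = 0.
  by move: v1; rewrite vE mulr1 => /eqP; rewrite mulf_eq0 (negbTE c0)/= => /eqP.
exists k, c; split=> //.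
- by rewrite -s2 sk.
- have := inner_sine_mode k0; rewrite /sine_mode -sk => h.
  by move: iv; rewrite ivE h => /(congr1 (fun t => t * 2)); rewrite mulfVK// mul1r.
- by move: uv; rewrite vE sk.
Qed.

End Eigenfunctions.

(** * First variations and critical amplitudes *)

Section CriticalPoints.
Variable R : realType.
Implicit Types (f g u v h w p q psi phi eta : R -> R).
Local Notation mu := (@lebesgue_measure R).
Local Notation II := (@I01 R).
Local Notation L2 := (@square_integrable R).
Local Notation Rint01 f := (Rintegral mu II f).

Lemma first_variation_quad (F : (R -> R) -> R) phi psi (A B C c : R) :
  (forall t : R, F (fun x => phi x + t * psi x) = A + 2 * t * B + t ^+ 2 * C) ->
  first_variation F phi psi c <-> c = 2 * B.
Proof.
move=> FE; rewrite /first_variation.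
have -> : (fun t : R => F (fun x => phi x + t * psi x)) =
    (fun t : R => A + t * (2 * B + C * t)).
  by apply/funext => t; rewrite FE; ring.
have d : is_derive (0 : R) 1 (fun t : R => A + t * (2 * B + C * t)) (2 * B).
  have d1 := is_derive_cmul C (is_derive_id (0 : R) 1).
  have d2 := is_derive_add (is_derive_cst (2 * B) (0 : R) 1) d1.
  have d3 := is_derive_mul (is_derive_id (0 : R) 1) d2.
  apply: is_derive_eq (is_derive_add (is_derive_cst A (0 : R) 1) d3) _.
  by rewrite /=; ring.
split=> [dc|->//].
by rewrite -(@derive_val _ _ _ _ _ _ _ dc) (@derive_val _ _ _ _ _ _ _ d).
Qed.

Lemma mass_variation u v (c : R) : L2 u -> L2 v ->
  first_variation (@mass R) u v c <-> c = 2 * inner u v.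
Proof.
move=> su sv; apply: (@first_variation_quad _ _ _ (inner u u) (inner u v) (inner v v)) => t.
by rewrite massE inner_quad.
Qed.

Lemma amplitude_fisher_quad u g v h (t : R) : H10_graph u g -> H10_graph v h ->
  amplitude_fisher (fun x => u x + t * v x) =
  4 * inner g g + 2 * t * (4 * inner g h) + t ^+ 2 * (4 * inner h h).
Proof.
move=> ug vh; have [_ sg _] := ug; have [_ sh _] := vh.
rewrite (amplitude_fisherE (H10_graph_add t ug vh)) inner_quad//; ring.
Qed.

Lemma amplitude_variation u g v h (c : R) : H10_graph u g -> H10_graph v h ->
  first_variation (@amplitude_fisher R) u v c <-> c = 8 * inner g h.
Proof.
move=> ug vh; rewrite (@first_variation_quad _ _ _ (4 * inner g g) (4 * inner g h)
  (4 * inner h h)).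
  by rewrite mulrA (_ : 2 * 4 = 8 :> R)//; ring.
by move=> t; exact: amplitude_fisher_quad.
Qed.

Lemma lagrange_variation u g v h (m c : R) : H10_graph u g -> H10_graph v h ->
  first_variation (fun f => amplitude_fisher f - m * (mass f - 1)) u v c <->
  c = 8 * inner g h - 2 * m * inner u v.
Proof.
move=> ug vh; have [su _ _] := ug; have [sv _ _] := vh.
rewrite (@first_variation_quad _ _ _ (4 * inner g g - m * (inner u u - 1))
  (4 * inner g h - m * inner u v) (4 * inner h h - m * inner v v)).
  by rewrite (_ : 2 * _ = 8 * inner g h - 2 * m * inner u v)//; ring.
by move=> t; rewrite (amplitude_fisher_quad t ug vh) massE inner_quad//; ring.
Qed.

(** For any v, the function v - (u, v) u is tangent to the sphere at u; conversely, on
    tangent directions (u, v) = 0. *)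
Lemma critical_amplitudeP u g : H10_graph u g ->
  critical_amplitude u <-> inner u u = 1 /\ forall v h, H10_graph v h ->
    inner g h = inner g g * inner u v.
Proof.
move=> ug; have [su sg _] := ug; split=> [[_ m1 H]|[u1 H]].
  have u1 : inner u u = 1 by rewrite -massE.
  split=> // v h vh; have [sv sh _] := vh.
  set a := inner u v; have wz := H10_graph_add (- a) vh ug; have [sw sz _] := wz.
  have := H _ (H10_graph_H10 wz).
  rewrite (mass_variation _ su sw) innerDr ?innerZr//; [|exact: L2_scale].
  rewrite u1 mulr1 subrr mulr0 => /(_ erefl).
  rewrite (amplitude_variation _ ug wz) innerDr ?innerZr//; [|exact: L2_scale].
  by move=> e; rewrite mulrC; move: e; rewrite mulNr; move: (inner g h) (a * _) => y z; lra.
split; [exact: H10_graph_H10 ug|by rewrite massE|].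
move=> v /H10_H10_graph vh; have [sv _ _] := vh.
rewrite (mass_variation _ su sv) (amplitude_variation _ ug vh) (H _ _ vh).
by move=> /esym/eqP; rewrite mulf_eq0 pnatr_eq0/= => /eqP ->; rewrite !mulr0.
Qed.

Lemma critical_amplitude_classification phi : critical_amplitude phi ->
  exists (k : nat) (c : R), [/\ (0 < k)%N, c ^+ 2 = 2,
    eq_ae01 phi (fun x => c * sine_mode k x),
    inner (weak_derivative phi) (weak_derivative phi) = (k%:R * pi) ^+ 2 &
    forall v h, H10_graph v h ->
      inner (weak_derivative phi) h = (k%:R * pi) ^+ 2 * inner phi v].
Proof.
move=> cphi; have [/H10_H10_graph pg _ _] := cphi.
have [p1 H] := (critical_amplitudeP pg).1 cphi.
have ev : weak_eigen phi (weak_derivative phi)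
    (inner (weak_derivative phi) (weak_derivative phi)).
  by move=> eta te; exact: H (H10_graph_test te).
have [k [c [k0 lamE c2 phiE]]] := weak_eigen_classification pg p1 ev.
by exists k, c; split=> // v h vh; rewrite -lamE (H _ _ vh).
Qed.

(** * Harmonic kernels *)

Definition harmonic_amp k (x : R) := Num.sqrt 2 * sine_mode k x.
Definition dharmonic_amp k (x : R) := Num.sqrt 2 * dsine_mode k x.

Lemma sqrt2_sqr : Num.sqrt 2 ^+ 2 = 2 :> R.
Proof. exact: sqr_sqrtr. Qed.

Lemma H10_graph_harmonic_amp k : H10_graph (harmonic_amp k) (dharmonic_amp k).
Proof.
have sz : H10_graph (fun=> 0) (fun=> 0 : R).
  have tz : test_function (fun _ : R => 0 : R).
    have [e te _] := @test_integral_neq0 R; have := test_scale 0 te.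
    by under eq_fun do rewrite mul0r.
  have := H10_graph_test tz; congr H10_graph; apply/funext => x; exact: is_derive1.
have := H10_graph_add (Num.sqrt 2) sz (H10_graph_sine_mode R k).
by congr H10_graph; apply/funext => x; rewrite add0r.
Qed.

Lemma harmonic_amp_sqr k x : harmonic_amp k x ^+ 2 = harmonic_kernel R k x.
Proof. by rewrite /harmonic_amp exprMn sqrt2_sqr. Qed.

Lemma inner_harmonic_amp k : (0 < k)%N -> inner (harmonic_amp k) (harmonic_amp k) = 1.
Proof.
move=> k0; have ss := @sine_mode_L2 R k.
rewrite /harmonic_amp innerZl ?innerZr//; last exact: L2_scale.
by rewrite mulrA -expr2 sqrt2_sqr inner_sine_mode// mulfV.
Qed.

Lemma harmonic_amp_eigen k v h : H10_graph v h ->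
  inner (dharmonic_amp k) h = (k%:R * pi) ^+ 2 * inner (harmonic_amp k) v.
Proof.
move=> vh; have [sv sh _] := vh; have [_ sd _] := H10_graph_sine_mode R k.
rewrite [LHS](innerZl _ sd sh) [in RHS](innerZl _ (@sine_mode_L2 R k) sv).
by rewrite innerC (sine_mode_eigen k vh) [inner v _]innerC; ring.
Qed.

Lemma inner_dharmonic_amp k : (0 < k)%N ->
  inner (dharmonic_amp k) (dharmonic_amp k) = (k%:R * pi) ^+ 2.
Proof.
move=> k0; rewrite (harmonic_amp_eigen k (H10_graph_harmonic_amp k)).
by rewrite inner_harmonic_amp// mulr1.
Qed.

Lemma harmonic_measurable k : measurable_fun II (harmonic_kernel R k).
Proof.
have -> : harmonic_kernel R k = (fun x => harmonic_amp k x ^+ 2)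
  by apply/funext => x; rewrite harmonic_amp_sqr.
have [/L2P[m _] _ _] := H10_graph_harmonic_amp k; exact: measurable_funX.
Qed.

(** The zeros of the amplitude in the interval are the countably many j/k. *)
Lemma harmonic_amp_zero_ae k : (0 < k)%N -> {ae mu, forall x, II x ->
  harmonic_amp k x = 0 -> dharmonic_amp k x = 0}.
Proof.
move=> k0.
(* j = 0 also excludes the endpoint 0. *)
have h : {ae mu, forall (x : R) (j : nat), x != j%:R / k%:R}.
  by apply: ae_foralln => j; exact: ae_neq.
apply: filterS h => x xj; rewrite I01E => /andP[x0 _] /eqP.
have kn0 : k%:R != 0 :> R by rewrite pnatr_eq0 -lt0n.
rewrite mulf_eq0 sqrtr_eq0 leNgt ltr0n/= => /eqP sx.
have {}x0 : 0 < x.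
  by rewrite lt_neqAle x0 andbT eq_sym; have := xj 0%N; rewrite mul0r.
have [|j _ xE] := sin_zero _ sx.
  by rewrite !mulr_gt0 ?pi_gt0// ltr0n.
have := xj j; rewrite eq_sym => /eqP; case.
have p0 : pi != 0 :> R by rewrite gt_eqF ?pi_gt0.
apply: (mulIf p0); rewrite mulrAC -xE; field.
exact: kn0.
Qed.

Lemma fisher_ae_harmonic k w : (0 < k)%N -> measurable_fun II w ->
  eq_ae01 w (harmonic_kernel R k) -> fisher w = (4 * k%:R ^+ 2 * pi ^+ 2)%:E.
Proof.
move=> k0 mw wk; rewrite (fisher_amplitude (H10_graph_harmonic_amp k) mw _
  (harmonic_amp_zero_ae k0)).
  by rewrite inner_dharmonic_amp// exprMn mulrA.
by apply: filterS wk => x h /h ->; rewrite harmonic_amp_sqr.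
Qed.

Lemma fisher_harmonic k : (0 < k)%N ->
  fisher (harmonic_kernel R k) = (4 * k%:R ^+ 2 * pi ^+ 2)%:E.
Proof.
move=> k0; apply: fisher_ae_harmonic => //; first exact: harmonic_measurable.
exact: eq_ae01_refl.
Qed.

(** The Fisher information depends only on the class of the kernel up to null sets, and
    it determines k. *)
Lemma harmonic_inj j k : (0 < j)%N -> (0 < k)%N ->
  eq_ae01 (harmonic_kernel R j) (harmonic_kernel R k) -> j = k.
Proof.
move=> j0 k0 jk.
have := fisher_ae_harmonic k0 (@harmonic_measurable j) jk.
rewrite fisher_harmonic// => -[].
have p0 : pi ^+ 2 != 0 :> R by rewrite expf_neq0// gt_eqF ?pi_gt0.
have n0 : 4 != 0 :> R by rewrite pnatr_eq0.
move=> /(mulIf p0) /(mulfI n0) /eqP; rewrite -!natrX eqr_nat eqn_exp2r// => /eqP.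
exact.
Qed.

Lemma multiple_sine_mode_sqr k phi (c : R) : c ^+ 2 = 2 ->
  eq_ae01 phi (fun x => c * sine_mode k x) ->
  eq_ae01 (fun x => phi x ^+ 2) (harmonic_kernel R k).
Proof.
by move=> c2; apply: filterS => x h /h ->; rewrite exprMn c2.
Qed.

Lemma critical_kernelP w : critical_kernel w <->
  exists k : nat, (0 < k)%N /\ eq_ae01 w (harmonic_kernel R k).
Proof.
split=> [[phi [/critical_amplitude_classification[k [c [k0 c2 phiE _ _]]]] wphi]|].
  by exists k; split=> //; exact: eq_ae01_trans wphi (multiple_sine_mode_sqr c2 phiE).
move=> [k [k0 wk]]; exists (harmonic_amp k); split.
  apply/(critical_amplitudeP (H10_graph_harmonic_amp k)); split;
    first exact: inner_harmonic_amp.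
  by move=> v h vh; rewrite inner_dharmonic_amp//; exact: harmonic_amp_eigen.
by apply: eq_ae01_trans wk _; apply: aeW => x _; rewrite harmonic_amp_sqr.
Qed.

(** The integer j given by the classification is k by [harmonic_inj].  Testing the
    multiplier equation with phi itself determines m. *)
Lemma critical_value (k : nat) phi : (0 < k)%N -> critical_amplitude phi ->
  eq_ae01 (fun x => phi x ^+ 2) (harmonic_kernel R k) ->
  amplitude_fisher phi = 4 * k%:R ^+ 2 * pi ^+ 2 /\
  forall m : R, lagrange_multiplier phi m <-> m = 4 * k%:R ^+ 2 * pi ^+ 2.
Proof.
move=> k0 cphi phik; have [/H10_H10_graph pg p1 _] := cphi.
have [j [c [j0 c2 phiE Dj ev]]] := critical_amplitude_classification cphi.
have jk : j = k.
  apply: harmonic_inj => //.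
  exact: eq_ae01_trans (eq_ae01_sym (multiple_sine_mode_sqr c2 phiE)) phik.
rewrite {j}jk in j0 phiE Dj ev.
have E : 4 * k%:R ^+ 2 * pi ^+ 2 = 4 * (k%:R * pi) ^+ 2 :> R by ring.
split; first by rewrite (amplitude_fisherE pg) Dj E.
move=> m; rewrite E; split=> [|->] H.
  have := H _ (H10_graph_H10 pg); rewrite (lagrange_variation _ _ pg pg) Dj -massE p1.
  by move: ((_ * _) ^+ 2) => y e; lra.
move/H10_H10_graph => vh; apply/(lagrange_variation _ _ pg vh); rewrite (ev _ _ vh).
by move: (inner _ _) ((_ * _) ^+ 2) => y z; ring.
Qed.

(** * Minimizers *)

Lemma admissible_H10_graph w : admissible_kernel w -> exists g,
  [/\ H10_graph (fun x => Num.sqrt (w x)) g,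
      inner (fun x => Num.sqrt (w x)) (fun x => Num.sqrt (w x)) = 1,
      eq_ae01 w (fun x => Num.sqrt (w x) ^+ 2) & fisher w = (4 * inner g g)%:E].
Proof.
move=> [[mw w0 w1] /H10_H10_graph wg]; exists (weak_derivative (fun x => Num.sqrt (w x))).
have [su _ _] := wg; have [ms is_] := (L2P _).1 su.
have wE : eq_ae01 w (fun x => Num.sqrt (w x) ^+ 2).
  by apply: filterS w0 => x h /h w0x; rewrite sqr_sqrtr.
split=> //.
  rewrite inner_sqr -(ae_eq_Rint01 mw _ wE); last exact: measurable_funX.
  by rewrite /Rintegral w1.
apply: (fisher_amplitude wg mw wE).
apply: (H10_graph_ge0_zero wg); apply: aeW => x _; exact: sqrtr_ge0.
Qed.

Lemma linear_coeff_eq0 (B C : R) : (forall t, 0 <= 2 * t * B + t ^+ 2 * C) -> B = 0.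
Proof.
move=> H; apply/eqP/negPn/negP => B0.
have C0 : 0 <= C by have := H 1; have := H (-1); lra.
(* C + 1 rather than C, which may be 0. *)
have := H (- B / (C + 1)).
have -> : 2 * (- B / (C + 1)) * B + (- B / (C + 1)) ^+ 2 * C =
  - (B ^+ 2 / (C + 1) ^+ 2 * (C + 2)).
  by field; lra.
rewrite oppr_ge0 leNgt => /negP; apply.
have p1 : 0 < C + 1 by lra.
have p2 : 0 < C + 2 by lra.
have B2 : 0 < B ^+ 2 by rewrite lt0r sqrf_eq0 B0 sqr_ge0.
by apply: mulr_gt0 => //; apply: divr_gt0 => //; exact: exprn_gt0.
Qed.

(** Equality means that t = 0 minimizes the difference of the two sides of the Poincaré
    inequality at u + t eta, so its linear coefficient in t vanishes. *)
Lemma poincare_eq_eigen u g : H10_graph u g -> inner g g = pi ^+ 2 * inner u u ->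
  weak_eigen u g (pi ^+ 2).
Proof.
move=> ug E eta te; have eh := H10_graph_test te.
have [su sg _] := ug; have [se sh _] := eh.
apply/eqP; rewrite -subr_eq0; apply/eqP.
apply: (@linear_coeff_eq0 _
  (inner (derive1 eta) (derive1 eta) - pi ^+ 2 * inner eta eta)) => t.
have := poincare (H10_graph_add t ug eh); rewrite !inner_quad// -subr_ge0 E.
by congr (_ <= _); ring.
Qed.

Lemma minimum_unique w : admissible_kernel w -> fisher w = (4 * pi ^+ 2)%:E ->
  eq_ae01 w (harmonic_kernel R 1).
Proof.
move=> /admissible_H10_graph[g [ug u1 wE ->]] [].
have n0 : 4 != 0 :> R by rewrite pnatr_eq0.
move=> /(mulfI n0) E.
have ev : weak_eigen (fun x => Num.sqrt (w x)) g (pi ^+ 2).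
  by apply: poincare_eq_eigen => //; rewrite u1 mulr1.
have [k [c [k0 lamE c2 uE]]] := weak_eigen_classification ug u1 ev.
have k1 : k = 1%N.
  have p0 : pi ^+ 2 != 0 :> R by rewrite expf_neq0// gt_eqF ?pi_gt0.
  move: lamE; rewrite exprMn -[X in X = _]mul1r => /(mulIf p0) /esym/eqP.
  by rewrite -[X in _ == X](expr1n R 2) eqrXn2// ?ler01// pnatr_eq1 => /eqP.
rewrite k1 in uE; exact: eq_ae01_trans wE (multiple_sine_mode_sqr c2 uE).
Qed.

(** The square root of 2 sin(pi x)^2 is a positive multiple of |sin(pi x)|, which is
    smooth only because the sine is nonnegative on the unit interval. *)
Lemma harmonic1_admissible : admissible_kernel (harmonic_kernel R 1).
Proof.
have i1 := @inner_harmonic_amp 1 isT; have ua := H10_graph_harmonic_amp 1;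
  have [sa sda _] := ua.
have [ma ia] := (L2P _).1 sa; have [mda _] := (L2P _).1 sda.
have hE : (fun x => harmonic_amp 1 x ^+ 2) = harmonic_kernel R 1.
  by apply/funext => x; exact: harmonic_amp_sqr.
split.
  split; first exact: harmonic_measurable.
    by apply: aeW => x _; rewrite -hE; exact: sqr_ge0.
  by rewrite -hE (Rint01_EFin ia) -inner_sqr i1.
rewrite -hE; apply: (@H10_graph_H10 _ _ (dharmonic_amp 1)).
have am x : II x -> harmonic_amp 1 x = Num.sqrt (harmonic_amp 1 x ^+ 2).
  rewrite I01E => /andP[x0 x1]; rewrite sqrtr_sqr ger0_norm//.
  rewrite mulr_ge0// /sine_mode mul1r; apply: sin_ge0_pi.
  by rewrite mulr_ge0 ?pi_ge0//= ger_pMr ?pi_gt0.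
apply: H10_graph_ae ua _ _ _ (@eq_ae01_refl _ _) => //; last exact: aeW.
apply: eq_measurable_fun ma => x /set_mem; exact: am.
Qed.

End CriticalPoints.

Theorem theorem5 (R : realType) :
  (let w0 : R -> R := fun z => 2 * sin (pi * z) ^+ 2 in
   [/\ admissible_kernel w0,
       fisher w0 = (4 * pi ^+ 2)%:E,
       (forall w : R -> R, admissible_kernel w -> (fisher w0 <= fisher w)%E) &
       (forall w : R -> R, admissible_kernel w -> fisher w = fisher w0 ->
          eq_ae01 w w0)]) /\
  (forall w : R -> R, critical_kernel w <->
     exists k : nat, (0 < k)%N /\ eq_ae01 w (harmonic_kernel R k)) /\
  (forall k : nat, (0 < k)%N ->
     fisher (harmonic_kernel R k) = (4 * k%:R ^+ 2 * pi ^+ 2)%:E) /\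
  (forall (k : nat) (phi : R -> R), (0 < k)%N -> critical_amplitude phi ->
     eq_ae01 (fun x => phi x ^+ 2) (harmonic_kernel R k) ->
     amplitude_fisher phi = 4 * k%:R ^+ 2 * pi ^+ 2 /\
     forall m : R, lagrange_multiplier phi m <-> m = 4 * k%:R ^+ 2 * pi ^+ 2).
Proof.
split; last by split; [exact: critical_kernelP|split;
  [exact: fisher_harmonic|exact: critical_value]].
move=> w0; have -> : w0 = harmonic_kernel R 1.
  by apply/funext => z; rewrite /w0 /harmonic_kernel mul1r.
have F : fisher (harmonic_kernel R 1) = (4 * pi ^+ 2)%:E.
  by rewrite fisher_harmonic// expr1n mulr1.
split=> //; first exact: harmonic1_admissible.
  move=> w /admissible_H10_graph[g [ug u1 _ ->]]; rewrite F lee_fin ler_pM2l//.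
  by have := poincare ug; rewrite u1 mulr1.
by move=> w aw; rewrite F; exact: minimum_unique.
Qed.
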